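(* Let $N\ge1$ and $[N]=\{1,\dots,N\}$. Let $\xi_{1,i}$ and $\xi_{2,i}$, $i\in[N]$, be nonnegative random variables such that $\xi_{1,i}\le\xi_{2,i}$ for $i\in[N]$, and let $Q^{(1)}=(q^{(1)}_{ij})$, $Q^{(2)}=(q^{(2)}_{ij})\in\mathbb R^{N\times N}$ be such that $q^{(1)}_{ij}\ge q^{(2)}_{ij}\ge0$ for $i,j\in[N]$. Let $\mathbf W=(W^1,\dots,W^N)$ be an $N$-dimensional Brownian motion with covariance matrix $A=(a_{ij})$, independent of the initial conditions. For $k=1,2$, let $(\mathbf L^k,\tau_k)$ be the unique maximal solution to the reflected SDE $$X^{k,i}_t=\xi_{k,i}+W^i_t-\sum_{j=1}^N q^{(k)}_{ij}L^{k,j}_t+L^{k,i}_t,\qquad i\in[N],$$ and let $(\mathbf X^k,\mathbf L^k)$ be the solution of the associated Skorokhod problem. Then (almost surely) $$X^{1,i}_t\le X^{2,i}_t\quad\text{and}\quad L^{1,i}_t-L^{1,i}_s\ge L^{2,i}_t-L^{2,i}_s$$ for all $0\le s\le t<\tau_1\wedge\tau_2$ and $i\in[N]$.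
   Context: Skorokhod problem. For a stopping time $\tau\in[0,\infty]$ and a càdlàg process $Z$ on $[0,\tau)$ with $Z_0\ge0$, a pair of càdlàg processes $(X,L)$ on $[0,\tau)$ solves the Skorokhod problem for $Z$ if $L$ is nondecreasing started from zero, $X_t=Z_t+L_t\ge0$ and $\int_0^t\mathbf 1_{\{X_s>0\}}\,dL_s=0$ for $t\in[0,\tau)$; the unique solution is $L_t=\sup_{0\le s\le t}(Z_s)_-$, $X=Z+L$, where $x_-=\max(-x,0)$. Active nodes. For a nonnegative matrix $Q=(q_{ij})$ and $I\subset[N]$ let $E_I=\{(i,j)\in I\times I:q_{ji}>0\}$. The set $I^a\subset I$ of active nodes consists of those $i\in I$ for which there exist $j\in I$ with $a_{jj}>0$ and a path $(i_0,\dots,i_n)$, $n\ge0$, with all $i_k\in I$, $i_0=j$, $i_n=i$ and $(i_k,i_{k+1})\in E_I$ for $k<n$. Solution. For nonnegative initial conditions $(\xi_i)$ and nonnegative $Q$, a solution of $X^i_t=\xi_i+W^i_t-\sum_jq_{ij}L^j_t+L^i_t$ is a pair $(\mathbf L,\tau)$ of a continuous adapted process $\mathbf L=(L^1,\dots,L^N)$ and a stopping time $\tau$ (with respect to the filtration $\mathcal F^N_t=\sigma(\xi_i,W^i_s:s\le t,\ i\in[N])$) such that (1) for every $i$ the solution $(X^i,F^i)$ to the Skorokhod problem for $\xi_i+W^i-\sum_jq_{ij}L^j$ on $[0,\tau)$ satisfies $F^i=L^i$ on $[0,\tau)$, and (2) $L^i_t=\int_0^t\mathbf 1_{\{i\in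 I^a_s\}}\,dL^i_s$ for $t\in[0,\tau)$, where $I_t=\{i:X^i_t=0\}$ and $I^a_t=(I_t)^a$. With $\mathbf X=(X^1,\dots,X^N)$, $(\mathbf X,\mathbf L)$ is the solution to the Skorokhod problem associated to $(\mathbf L,\tau)$. The solution is maximal if for any other solution $(\mathbf L',\tau')$ with $\mathbf L'=\mathbf L$ on $[0,\tau'\wedge\tau)$ one has $\tau\ge\tau'$. A unique maximal solution always exists. *)

(* Defs.v *)
From HB Require Import structures.
From mathcomp Require Import all_boot all_order all_algebra.
From mathcomp Require Import all_classical all_reals all_analysis.

Set Implicit Arguments.
Unset Strict Implicit.
Unset Printing Implicit Defensive.

Import Order.TTheory GRing.Theory Num.Theory.
Import numFieldNormedType.Exports.

Local Open Scope classical_set_scope.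
Local Open Scope ring_scope.

(** Conventions.  A real process indexed by [N] is a map
    [X : 'I_N -> T -> R -> R], so that [X i w] is a path and [X i w t] its value
    at time [t].  Only times [t >= 0] matter; a process on a random interval
    [0, tau) has arbitrary values outside of it.  Path properties and relations
    between random variables are required to hold almost surely. *)

Section Stieltjes.
Variable R : realType.

(** [F] on [0, t], extended by constants to the whole line. *)
Definition clamp (F : R -> R) (t : R) : R -> R :=
  fun s => F (Num.min (Num.max s 0) t).

Definition is_cumulative (F : R -> R) : Prop :=
  nondecreasing F /\ right_continuous F.

(** [F] if it is a distribution function, the junk value [0] otherwise: this
    makes the measure [dF] a total function of [F]. *)
Definition to_cumulative (F : R -> R) : R -> R :=
  if `[< is_cumulative F >] then F else cst 0.

Lemma to_cumulativeP (F : R -> R) : is_cumulative (to_cumulative F).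
Proof.
rewrite /to_cumulative; case: asboolP => // _; split => //.
by move=> x; exact: cvg_cst.
Qed.

Lemma to_cumulativeE (F : R -> R) : is_cumulative F -> to_cumulative F = F.
Proof. by move=> F_cum; rewrite /to_cumulative; case: asboolP. Qed.

HB.instance Definition _ (F : R -> R) :=
  isCumulative.Build R _ R (to_cumulative F)
    (to_cumulativeP F).1 (to_cumulativeP F).2.

(** The integral of [g] against [dF] over [0, t], for [F] nondecreasing and
    right-continuous on [0, t].  Since [clamp F t] is constant on the negative
    half-line, [dF] has no atom at [0]. *)
Definition stieltjes_integral (F : R -> R) (t : R) (g : R -> R) : \bar R :=
  (\int[lebesgue_stieltjes_measure (to_cumulative (clamp F t))]_(s in `[0%R, t])
    (g s)%:E)%E.

(** The junk value is not used for the integrators considered below. *)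
Lemma is_cumulative_clamp (F : R -> R) (t : R) : 0 <= t ->
  (forall r s : R, 0 <= r -> r <= s -> s <= t -> F r <= F s) ->
  (forall s : R, 0 <= s -> s < t -> F x @[x --> s^'+] --> F s) ->
  is_cumulative (clamp F t).
Proof.
move=> t0 Fnd Frc; split => [r s rs|s].
  apply: Fnd.
  - by rewrite le_min t0 andbT le_max lexx orbT.
  - have le0 : Num.max r 0 <= Num.max s 0.
      by rewrite ge_max !le_max rs lexx orbT.
    by rewrite le_min !ge_min le0 lexx orbT.
  - by rewrite ge_min lexx orbT.
have [ts|st] := leP t s.
  have -> : clamp F t s = F t.
    by rewrite /clamp (max_idPl (le_trans t0 ts)) (min_idPr ts).
  apply: cvg_near_cst; near=> x.
  have tx : t <= x by apply: (le_trans ts); near: x; exact: nbhs_right_ge.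
  by rewrite /clamp (max_idPl (le_trans t0 tx)) (min_idPr tx).
have [s0|s0] := ltP s 0.
  have -> : clamp F t s = F 0.
    by rewrite /clamp (max_idPr (ltW s0)) (min_idPl t0).
  apply: cvg_near_cst; near=> x.
  have x0 : x <= 0 by near: x; exact: nbhs_right_le.
  by rewrite /clamp (max_idPr x0) (min_idPl t0).
have -> : clamp F t s = F s.
  by rewrite /clamp (max_idPl s0) (min_idPl (ltW st)).
apply: cvg_trans (Frc s s0 st); apply: near_eq_cvg; near=> x.
have sx : s <= x by near: x; exact: nbhs_right_ge.
have xt : x <= t by near: x; exact: nbhs_right_le.
by rewrite /clamp (max_idPl (le_trans s0 sx)) (min_idPl xt).
Unshelve. all: by end_near. Qed.

End Stieltjes.

Section Skorokhod.
Variable R : realType.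

Definition cadlag (tau : \bar R) (F : R -> R) : Prop :=
  (forall t : R, 0 <= t -> (t%:E < tau)%E -> F x @[x --> t^'+] --> F t) /\
  (forall t : R, 0 < t -> (t%:E < tau)%E -> cvg (F x @[x --> t^'-])).

(** [(X, L)] solves the Skorokhod problem for [Z].  That [Z] is cadlag with
    [0 <= Z 0] follows from these conditions. *)
Definition skorokhod (tau : \bar R) (Z X L : R -> R) : Prop :=
  [/\ cadlag tau X /\ cadlag tau L,
      (0 < tau)%E -> L 0 = 0,
      forall s t : R, 0 <= s -> s <= t -> (t%:E < tau)%E -> L s <= L t,
      forall t : R, 0 <= t -> (t%:E < tau)%E -> X t = Z t + L t /\ 0 <= X t &
      forall t : R, 0 <= t -> (t%:E < tau)%E ->
        stieltjes_integral L t (\1_[set s | 0 < X s]) = 0%E].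

End Skorokhod.

Section Active.
Variables (R : realType) (N : nat).

Definition edge (Q : 'M[R]_N) (I : {set 'I_N}) : rel 'I_N :=
  fun i j => [&& i \in I, j \in I & 0 < Q j i].

Definition active (A Q : 'M[R]_N) (I : {set 'I_N}) : {set 'I_N} :=
  [set i in I | [exists j in I, (0 < A j j) && connect (edge Q I) j i]]%SET.

End Active.

Section Probability.
Context {d : measure_display} {T : measurableType d} {R : realType}.
Implicit Types (P : probability T R) (tau : T -> \bar R).

Definition events (J : Type) (D : set J) (Y : J -> T -> R) : set (set T) :=
  \bigcup_(j in D) preimage_set_system setT (Y j) measurable.

Definition independent P (F G : set (set T)) : Prop :=
  forall A B, F A -> G B -> P (A `&` B) = (P A * P B)%E.

(** The centered normal law of variance [v]; [normal_prob 0 0] is not the Dirac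
    mass at [0]. *)
Definition centered_normal (v : R) (B : set R) : \bar R :=
  if v == 0 then \d_(0 : R) B else normal_prob 0 (Num.sqrt v) B.

Definition past N (W : 'I_N -> T -> R -> R) (t : R) : set (set T) :=
  events [set iu : 'I_N * R | 0 <= iu.2 <= t] (fun iu w => W iu.1 w iu.2).

(** [W t - W s] is a Gaussian vector of covariance [(t - s) A], i.e. each of its
    linear combinations is normal with the corresponding variance. *)
Definition brownian P N (A : 'M[R]_N) (W : 'I_N -> T -> R -> R) : Prop :=
  [/\ A^T = A /\ (forall u : 'rV[R]_N, 0 <= (u *m A *m u^T) 0 0),
      forall i (t : R), 0 <= t -> measurable_fun setT (fun w => W i w t),
      {ae P, forall w, forall i,
        W i w 0 = 0 /\ {within [set t | 0 <= t], continuous (W i w)}},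
      forall s t : R, 0 <= s -> s <= t ->
        independent P <<s past W s >>
          <<s events [set: 'I_N] (fun i w => W i w t - W i w s) >> &
      forall (s t : R) (u : 'rV[R]_N) (B : set R), 0 <= s -> s <= t -> measurable B ->
        P ((fun w => \sum_i u 0 i * (W i w t - W i w s)) @^-1` B) =
        centered_normal ((t - s) * (u *m A *m u^T) 0 0) B].

Definition stopping_time (F : R -> set (set T)) tau : Prop :=
  (forall w, (0 <= tau w)%E) /\
  (forall t : R, 0 <= t -> F t [set w | (tau w <= t%:E)%E]).

(** The requirement only concerns the values of [L] on [0, tau). *)
Definition adapted (F : R -> set (set T)) tau N (L : 'I_N -> T -> R -> R)
    : Prop :=
  forall i (t : R) (B : set R), 0 <= t -> measurable B ->
    F t ([set w | (t%:E < tau w)%E] `&` [set w | B (L i w t)]).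

Definition filtration N (xi : 'I_N -> T -> R) (W : 'I_N -> T -> R -> R) (t : R)
    : set (set T) :=
  <<s events [set: 'I_N] xi `|` past W t >>.

(** [(X, L)] is the solution of the Skorokhod problem associated to
    [(L, tau)]. *)
Definition associated P N (Q : 'M[R]_N) (xi : 'I_N -> T -> R)
    (W L : 'I_N -> T -> R -> R) tau (X : 'I_N -> T -> R -> R) : Prop :=
  {ae P, forall w, forall i,
    skorokhod (tau w)
      (fun t => xi i w + W i w t - \sum_j Q i j * L j w t) (X i w) (L i w)}.

Definition zero_set N (X : 'I_N -> T -> R -> R) (w : T) (t : R) : {set 'I_N} :=
  [set i | X i w t == 0]%SET.

Definition solution P N (A Q : 'M[R]_N) (xi : 'I_N -> T -> R)
    (W L : 'I_N -> T -> R -> R) tau : Prop :=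
  [/\ stopping_time (filtration xi W) tau,
      adapted (filtration xi W) tau L,
      {ae P, forall w, forall i,
        {within [set t | 0 <= t /\ (t%:E < tau w)%E], continuous (L i w)}} &
      exists2 X : 'I_N -> T -> R -> R, associated P Q xi W L tau X &
        {ae P, forall w, forall i (t : R), 0 <= t -> (t%:E < tau w)%E ->
          (L i w t)%:E = stieltjes_integral (L i w) t
            (\1_[set s | i \in active A Q (zero_set X w s)])}].

Definition maximal_solution P N (A Q : 'M[R]_N) (xi : 'I_N -> T -> R)
    (W L : 'I_N -> T -> R -> R) tau : Prop :=
  solution P A Q xi W L tau /\
  forall (L' : 'I_N -> T -> R -> R) (tau' : T -> \bar R),
    solution P A Q xi W L' tau' ->
    {ae P, forall w, forall i (t : R), 0 <= t -> (t%:E < tau' w)%E ->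
      (t%:E < tau w)%E -> L' i w t = L i w t} ->
    {ae P, forall w, (tau' w <= tau w)%E}.

End Probability.

(* Main.v *)
(** Pathwise, [L2] is locally the only fixed point of a monotone map, and [L1] is a
    supersolution of the corresponding equation, as long as the matrix [Q2]
    restricted to the active nodes [K] of [X2] admits [u > 0] with [Q2 u < u] on [K].
    Indeed, if the increments of [D = L2 - L1] are at most [m u], then looking back
    to the last zeros of [X2] and [X1] shows that they are at most [m Q2 u].

    If there is no such [u], there is [v >= 0] carried by [K], [v <> 0], with
    [v Q2 >= v] on [K], and since all nodes of [K] are active, [v] can be chosen with
    [v j > 0] for some [j] with [a_jj > 0].  Then [v X2] is nonnegative and its
    increments are at most those of the Brownian motion [v W], so almost surely it
    cannot vanish before [tau2]: if [v A v^T > 0], the Brownian motion immediately takes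
    negative values after the first (approximate) hitting time of zero; if [v A v^T = 0],
    [v X2] would remain zero, and [W j] would have bounded variation on an interval.
    Hence almost surely [u] exists at all times [t < tau2], and the comparison
    follows by continuous induction. *)

(* The alternative between [u] and [v] depends on the zero set only, and there are finitely many
   such sets: one [v] is fixed in advance for each of them and costs one null event, although the
   zero set at time [t] is random. The obstacle in the probabilistic half is that [v X2] would
   vanish at a random time, whereas the independence of increments is available at deterministic
   times. The hitting of zero is therefore replaced by the first point of a deterministic grid at
   which [v X2 <= delta]. This asks for a bound on the probability that [v W] stays above [- delta]
   that is uniform in the starting time and tests finitely many later times; geometrically growing
   times provide it. In the deterministic half, the zero set of [X2] can only shrink just after a
   given time, by continuity, so the weights [u] found at that time remain valid on a short
   interval, where the strict inequality [Q2 u < u] becomes a contraction factor below one. *)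
Require Import Defs.
From mathcomp Require Import all_boot all_order all_algebra.
From mathcomp Require Import all_classical all_reals all_analysis.
From mathcomp Require Import measurable_realfun normal_distribution ring lra.
Import Order.TTheory GRing.Theory Num.Theory.
Import numFieldNormedType.Exports.

Set Implicit Arguments.
Unset Strict Implicit.
Unset Printing Implicit Defensive.

Local Open Scope classical_set_scope.
Local Open Scope ring_scope.

(** * Left and right subsolutions of nonnegative matrices *)

Section Alternative.
Variables (R : realFieldType) (N : nat).
Implicit Types (Q : 'M[R]_N) (K : {set 'I_N}) (u v : 'I_N -> R).

(** For [Q >= 0] such a [u] exists exactly when the spectral radius of [Q] restricted to [K] is
    below one. Positivity is asked off [K] too, so that [u] can weigh all nodes at once. *)
Definition strict_supersolution Q K u :=
  (forall i, 0 < u i) /\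
  (forall i, i \in K -> \sum_(j in K) Q i j * u j < u i).

(** The sum may run over all nodes because [v] vanishes off [K]; hence a subsolution carried by [K]
    is also one for every larger set. *)
Definition left_subsolution Q K v :=
  [/\ forall i, 0 <= v i, forall i, i \notin K -> v i = 0 &
      forall j, v j <= \sum_i v i * Q i j].

Lemma exists_small_scale (I : finType) (c s : I -> R) :
  (forall i, 0 < s i) -> exists2 e : R, 0 < e & forall i, c i * e < s i.
Proof.
move=> s_gt0.
have d_gt0 i : 0 < 1 + `|c i| by apply: ltr_pwDl.
exists (\big[Num.min/1]_i (s i / (1 + `|c i|))).
  elim/big_ind: _ => // [x y x0 y0|i _]; first by rewrite lt_min x0.
  by rewrite divr_gt0.
move=> i; set e := \big[_/_]_i _.
have e_gt0 : 0 < e.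
  rewrite /e; elim/big_ind: _ => // [x y x0 y0|j _]; first by rewrite lt_min x0.
  by rewrite divr_gt0.
have le_e : e <= s i / (1 + `|c i|) by rewrite /e (bigD1 i)//= ge_min lexx.
rewrite ler_pdivlMr// in le_e.
apply: lt_le_trans le_e; rewrite mulrC ltr_pM2l//.
by apply: le_lt_trans (ler_norm _) _; rewrite ltrDr.
Qed.

(* Eliminating the index [k] replaces [Q] by the Schur complement
   [Q i j + Q i k Q k j / (1 - Q k k)]. *)
Lemma nonneg_mx_alternative Q K : (forall i j, 0 <= Q i j) ->
  (exists u, strict_supersolution Q K u) \/
  (exists2 v, left_subsolution Q K v & exists j, 0 < v j).
Proof.
elim: {K}_.+1 {-2}K (ltnSn #|K|) Q => // n IH K /ltnSE leKn Q Q_ge0.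
have [->|[k kK]] := set_0Vmem K.
  by left; exists (fun=> 1); split => // i; rewrite inE.
(* If [1 <= Q k k], the pivot [1 - Q k k] is unusable, but the unit vector at [k] is already a left
   subsolution. *)
have [Qkk|Qkk] := leP 1 (Q k k).
  right; exists (fun i => (i == k)%:R); last by exists k; rewrite eqxx.
  split=> [i|i|j]; first exact: ler0n.
    by case: eqP => // ->; rewrite kK.
  rewrite (bigD1 k)//= eqxx mul1r big1 ?addr0 => [|i /negPf->]; last by rewrite mul0r.
  by case: eqP => [->|_].
set d := 1 - Q k k; have d_gt0 : 0 < d by rewrite subr_gt0.
have d_neq0 : d != 0 by rewrite gt_eqF.
pose Q' := \matrix_(i, j) (Q i j + Q i k * Q k j / d).
pose K' := K :\ k.
have cardK' : (#|K'| < n)%N by rewrite /K' (cardsD1 k K) kK in leKn *.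
have Q'_ge0 i j : 0 <= Q' i j.
  by rewrite mxE addr_ge0 ?divr_ge0 ?mulr_ge0// ltW.
have sumK (F : 'I_N -> R) : \sum_(j in K) F j = F k + \sum_(j in K') F j.
  by rewrite (bigD1 k)//=; congr (_ + _); apply: eq_bigl => j; rewrite !inE andbC.
case: (IH _ cardK' _ Q'_ge0) => [[u [u_gt0 u_lt]]|[v [v_ge0 v_out v_le] [j0 vj0]]].
  (* [uk] solves row [k] with equality. Adding [e] makes this row strict because [Q k k < 1], and
     [e] is small enough for the slack [s i] of the other rows to absorb [Q i k * e]. *)
  left; pose uk := (\sum_(j in K') Q k j * u j) / d.
  have uk_ge0 : 0 <= uk.
    apply: divr_ge0; last exact: ltW.
    by apply: sumr_ge0 => j _; apply: mulr_ge0 => //; exact: ltW.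
  pose s i := if i \in K' then u i - \sum_(j in K') Q' i j * u j else 1.
  have s_gt0 i : 0 < s i.
    by rewrite /s; case: ifP => // iK'; rewrite subr_gt0 u_lt.
  have [e e_gt0 e_lt] := exists_small_scale (fun i => Q i k) s_gt0.
  exists (fun i => if i == k then uk + e else u i); split=> [i|i iK].
    by case: ifP => // _; rewrite ltr_wpDl.
  have sumE : \sum_(j in K') Q i j * (if j == k then uk + e else u j) =
              \sum_(j in K') Q i j * u j.
    by apply: eq_bigr => j; rewrite !inE => /andP[/negPf->].
  rewrite sumK sumE eqxx; case: (eqVneq i k) => [->|ik].
    have -> : \sum_(j in K') Q k j * u j = d * uk by rewrite /uk mulrCA divff ?mulr1.
    by rewrite /d; have := mulr_gt0 d_gt0 e_gt0; rewrite /d; lra.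
  have iK' : i \in K' by rewrite !inE ik.
  have := e_lt i; rewrite /s iK'.
  have -> : \sum_(j in K') Q' i j * u j =
      \sum_(j in K') Q i j * u j + Q i k * uk.
    rewrite /uk mulr_suml mulr_sumr -big_split/=; apply: eq_bigr => j _.
    by rewrite mxE; field.
  by lra.
right; have k_out : v k = 0 by apply: v_out; rewrite !inE eqxx.
(* This value gives equality in column [k]; the other columns then reproduce the Schur
   complement. *)
pose vk := (\sum_i v i * Q i k) / d.
have vk_ge0 : 0 <= vk.
  apply: divr_ge0; last exact: ltW.
  by apply: sumr_ge0 => j _; exact: mulr_ge0.
have sumE j : \sum_i (if i == k then vk else v i) * Q i j =
              vk * Q k j + \sum_i v i * Q i j.
  rewrite [in RHS](bigD1 k)//= (bigD1 k)//= eqxx k_out mul0r add0r; congr (_ + _).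
  by apply: eq_bigr => i /negPf->.
exists (fun i => if i == k then vk else v i); last first.
  by exists j0; case: eqP vj0 => // ->; rewrite k_out ltxx.
split=> [i|i iK|j]; first by case: ifP.
  case: eqP iK => [->|ik iK]; first by rewrite kK.
  by apply: v_out; rewrite !inE negb_and iK orbT.
rewrite sumE; case: eqP => [->|jk].
  have -> : \sum_i v i * Q i k = d * vk by rewrite /vk mulrCA divff ?mulr1.
  by rewrite /d; lra.
apply: le_trans (v_le j) _; rewrite /vk !mulr_suml -big_split/=.
apply: ler_sum => i _; rewrite mxE le_eqVlt; apply/orP; left.
  by apply/eqP; field.
Qed.

(* If [j] is in the support of [v] and [0 < Q j k], then [k] can be added to the
   support by passing to [M v + e_k] with [M] large. *)
Lemma left_subsolution_extend Q K v k : (forall i j, 0 <= Q i j) ->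
  left_subsolution Q K v -> k \in K -> v k = 0 ->
  (exists2 j, 0 < v j & 0 < Q j k) ->
  exists2 v', left_subsolution Q K v' &
    0 < v' k /\ forall j, 0 < v j -> 0 < v' j.
Proof.
move=> Q_ge0 [v_ge0 v_out v_le] kK vk0 [j vj Qjk].
set S := \sum_i v i * Q i k.
have S_gt0 : 0 < S.
  rewrite /S (bigD1 j)//=; apply: ltr_pwDl; first exact: mulr_gt0.
  by apply: sumr_ge0 => i _; exact: mulr_ge0.
exists (fun i => S^-1 * v i + (i == k)%:R); last first.
  split=> [|i vi]; first by rewrite vk0 eqxx mulr0 add0r.
  by rewrite ltr_pwDl ?ler0n// mulr_gt0 ?invr_gt0.
have Sv_ge0 i : 0 <= S^-1 * v i by rewrite mulr_ge0// invr_ge0 ltW.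
split=> [i|i iK|i]; first by rewrite addr_ge0 ?ler0n.
  by rewrite v_out// mulr0 add0r; case: eqP iK => // ->; rewrite kK.
have -> : \sum_l (S^-1 * v l + (l == k)%:R) * Q l i =
    S^-1 * (\sum_l v l * Q l i) + Q k i.
  rewrite mulr_sumr; under eq_bigr do rewrite mulrDl -mulrA.
  rewrite big_split/=; congr (_ + _); rewrite (bigD1 k)//= eqxx mul1r big1 ?addr0//.
  by move=> l /negPf->; rewrite mul0r.
case: (eqVneq i k) => [->|ik].
  by rewrite vk0 mulr0 add0r -/S mulVf ?gt_eqF// lerDl.
by rewrite addr0 -[leLHS]addr0 lerD// ler_wpM2l// invr_ge0 ltW.
Qed.

(** Each extension strictly enlarges the support, so the process stops, at a support closed under
    the positive entries of [Q] within [K]. *)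
Lemma left_subsolution_closed Q K v : (forall i j, 0 <= Q i j) ->
  left_subsolution Q K v ->
  exists2 v', left_subsolution Q K v' &
    (forall j, 0 < v j -> 0 < v' j) /\
    forall j k, 0 < v' j -> k \in K -> 0 < Q j k -> 0 < v' k.
Proof.
move=> Q_ge0; pose supp v := [set i | 0 < v i]%SET.
elim: {v}_.+1 {-2}v (ltnSn #|~: supp v|) => // n IH v /ltnSE le_n v_sub.
have [cl|] := boolP [forall j, forall k,
    (0 < v j) ==> (k \in K) ==> (0 < Q j k) ==> (0 < v k)].
  exists v => //; split=> // j k vj kK Qjk.
  by move: cl => /forallP/(_ j)/forallP/(_ k); rewrite vj kK Qjk.
rewrite negb_forall => /existsP[j]; rewrite negb_forall => /existsP[k].
rewrite !negb_imply => /and4P[vj kK Qjk vk].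
have vk0 : v k = 0.
  by case: v_sub => v_ge0 _ _; apply/eqP; rewrite eq_le v_ge0 andbT leNgt.
have [|v1 v1_sub [v1k v1_gt0]] := left_subsolution_extend Q_ge0 v_sub kK vk0.
  by exists j.
have [|v2 v2_sub [v2_gt0 v2_cl]] := IH v1 _ v1_sub; last first.
  by exists v2 => //; split=> // i /v1_gt0/v2_gt0.
apply: leq_trans le_n; apply: proper_card; apply/properP; split.
  by apply/fintype.subsetP => i; rewrite !inE; apply: contra => /v1_gt0.
by exists k; rewrite !inE // v1k.
Qed.

End Alternative.

(** Positivity of [v'] propagates against the arrows of [edge]: an edge from [i] to [l] means
    [0 < Q l i]. Some [j] in the support is active, so walking back along the path that activates it
    reaches its source [j0], where [A j0 j0 > 0]. All nodes of the path are active themselves, hence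
    in [K], where the support is closed. *)
Lemma active_alternative (R : realType) N (A Q : 'M[R]_N) (I : {set 'I_N}) :
  (forall i j, 0 <= Q i j) ->
  (exists u, strict_supersolution Q (active A Q I) u) \/
  (exists2 v, left_subsolution Q I v & exists2 j, 0 < v j & 0 < A j j).
Proof.
move=> Q_ge0; set K := active A Q I.
have [[u Hu]|[v v_sub [j vj]]] := nonneg_mx_alternative K Q_ge0.
  by left; exists u.
have [v' [v'_ge0 v'_out v'_le] [v'_gt0 v'_cl]] := left_subsolution_closed Q_ge0 v_sub.
have v'j := v'_gt0 _ vj.
have KI i : i \in K -> i \in I by rewrite inE => /andP[].
right; exists v'.
  by split=> // i iI; apply: v'_out; apply: contra iI => /KI.
have : j \in K by apply: contraTT v'j => /v'_out->; rewrite ltxx.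
rewrite inE => /andP[jI] /'exists_andP[j0 [j0I /andP[Aj0 /connectP[p]]]].
move=> pth jE; exists j0 => //.
have reachK i : i \in I -> connect (edge Q I) j0 i -> i \in K.
  by move=> iI ci; rewrite inE iI; apply/existsP; exists j0; rewrite j0I Aj0.
have {pth} : connect (edge Q I) j0 j0 /\ path (edge Q I) j0 p by [].
suff H i : connect (edge Q I) j0 i /\ path (edge Q I) i p -> j = last i p -> 0 < v' i.
  by move=> /H; apply.
elim: p i {jE} => [|l p IHp] i /= [ci]; first by move=> _ <-.
move=> /andP[eil pth] jE.
have cl : connect (edge Q I) j0 l := connect_trans ci (connect1 eil).
have v'l := IHp l (conj cl pth) jE.
case/and3P: eil => iI lI Qli; apply: v'_cl v'l _ Qli.
exact: reachK.
Qed.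

(** * Stieltjes integrals of indicator functions *)

Section StieltjesFacts.
Variable R : realType.

(** Argued on the supremum over simple functions, so that [A] and [B] can be arbitrary sets, such as
    the times at which a path is positive or a node is active. *)
Lemma integral_indic_le d (T : measurableType d)
    (mu : {measure set T -> \bar R}) (D A B : set T) : D `&` A `<=` B ->
  (\int[mu]_(x in D) (\1_A x)%:E <= \int[mu]_(x in D) (\1_B x)%:E)%E.
Proof.
move=> AB; have ind_ge0 C x : D x -> (0 <= (\1_C x)%:E :> \bar R)%E.
  by move=> _; rewrite lee_fin.
rewrite !ge0_integralE; [|by move=> x; exact: ind_ge0..].
apply: ge_ereal_sup => _ [h /= hA <-]; apply: ereal_sup_ubound.
exists h => //= x; apply: le_trans (hA x) _; rewrite /patch; case: ifPn => //.
move=> /set_mem Dx; rewrite lee_fin !indicE ler_nat.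
by case: (boolP (x \in A)) => // /set_mem Ax; rewrite mem_set//; exact: AB.
Qed.

Lemma stieltjes_itv (F : R -> R) (a b t : R) : is_cumulative (clamp F t) ->
  a <= b ->
  lebesgue_stieltjes_measure (to_cumulative (clamp F t)) `]a, b] =
  (clamp F t b - clamp F t a)%:E.
Proof.
move=> Fc ab.
rewrite /lebesgue_stieltjes_measure/= /measure_extension/= measurable_mu_extE/=.
  by rewrite wlength_itv_bnd// to_cumulativeE.
exact: is_ocitv.
Qed.

Section constancy.
Variables (F : R -> R) (a t : R) (A : set R).
Hypotheses (a0 : 0 <= a) (at_ : a <= t).
Hypothesis F_nd : forall r s : R, 0 <= r -> r <= s -> s <= t -> F r <= F s.
Hypothesis F_rc : forall s : R, 0 <= s -> s < t -> F x @[x --> s^'+] --> F s.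

Let t0 : 0 <= t. Proof. exact: le_trans a0 at_. Qed.
Let F_cum : is_cumulative (clamp F t).
Proof. exact: is_cumulative_clamp. Qed.

Let clampE s : 0 <= s -> s <= t -> clamp F t s = F s.
Proof. by move=> s0 st; rewrite /clamp (max_idPl s0) (min_idPl st). Qed.

Lemma stieltjes_integral0_constant :
  stieltjes_integral F t \1_A = 0%E -> `]a, t] `<=` A -> F t = F a.
Proof.
rewrite /stieltjes_integral => int0 sub.
have /(integral_indic_le (lebesgue_stieltjes_measure (to_cumulative (clamp F t)))) :
  `[0, t] `&` `]a, t] `<=` A by move=> x [_ /sub].
rewrite int0 integral_indic//.
rewrite setIidl; last first.
  move=> x /=; rewrite !in_itv/= => /andP[ax ->]; rewrite andbT.
  by apply: le_trans a0 _; exact: ltW.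
move=> mu0; have : ((clamp F t t - clamp F t a)%:E <= 0 :> \bar R)%E.
  by rewrite -stieltjes_itv.
rewrite lee_fin !clampE// subr_le0 => Fta.
by apply/eqP; rewrite eq_le Fta F_nd.
Qed.

(** The integral only charges the part of [A] in [[0, t]], which lies in []-1, a]], a set of mass
    [F a]. The endpoint [-1] stands for any negative number: [clamp F t] is equal to [F 0 = 0]
    there. *)
Lemma stieltjes_integral_full_constant : F 0 = 0 ->
  (F t)%:E = stieltjes_integral F t \1_A -> `]a, t] `&` A = set0 -> F t = F a.
Proof.
rewrite /stieltjes_integral => F0 intF disj.
have /(integral_indic_le (lebesgue_stieltjes_measure (to_cumulative (clamp F t)))) :
  `[0, t] `&` A `<=` `]-1, a].
  move=> x [/= ]; rewrite !in_itv/= => /andP[x0 xt] Ax; apply/andP; split; first lra.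
  rewrite leNgt; apply/negP => ax.
  suff : (set0 : set R) x by [].
  by rewrite -disj; split => //=; rewrite in_itv/= ax.
rewrite -intF integral_indic//.
move=> Ft; have : ((F t)%:E <= (clamp F t a - clamp F t (-1))%:E)%E.
  rewrite -stieltjes_itv//; last by apply: le_trans a0; lra.
  apply: le_trans Ft _; apply: le_measure; rewrite ?inE//.
  exact: measurableI.
rewrite lee_fin clampE// [clamp F t (-1)]/clamp max_r; last lra.
rewrite min_l// F0 subr0 => Fta.
by apply/eqP; rewrite eq_le Fta F_nd.
Qed.

End constancy.
End StieltjesFacts.

(** * Pathwise comparison *)

Lemma active_mono (R : realType) N (A Q : 'M[R]_N) (I J : {set 'I_N}) :
  I \subset J -> active A Q I \subset active A Q J.
Proof.
move=> /fintype.subsetP IJ; apply/fintype.subsetP => i; rewrite !inE => /andP[iI].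
move=> /'exists_andP[j [jI /andP[Aj ji]]]; rewrite IJ//=.
apply/existsP; exists j; rewrite IJ// Aj/=; move: ji; apply: connect_sub => k l.
move=> /and3P[kI lI Qkl]; apply: connect1.
by rewrite /edge IJ ?IJ.
Qed.

Section Continuity.
Variable R : realType.
Implicit Types (f : R -> R) (a b x : R).

Lemma within_continuous_dist (D : set R) f x e :
  {within D, continuous f} -> D x -> 0 < e ->
  exists2 d : R, 0 < d & forall y, D y -> `|y - x| < d -> `|f y - f x| < e.
Proof.
move=> /subspace_continuousP fc Dx e0.
have /cvgrPdist_lt/(_ e e0) := fc x Dx.
rewrite near_withinE => /nbhs_ballP[d /= d0 H]; exists d => // y Dy xy.
by rewrite distrC; apply: H => //; rewrite /ball /= distrC.
Qed.

Lemma continuous_last_zero f a b : a <= b -> {within `[a, b], continuous f} ->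
  (forall s, a <= s -> s <= b -> 0 <= f s) ->
  (forall s, a <= s -> s <= b -> 0 < f s) \/
  exists r, [/\ a <= r, r <= b, f r = 0 & forall s, r < s -> s <= b -> 0 < f s].
Proof.
move=> ab fc f0; have [f_gt0|] := pselect (forall s, a <= s -> s <= b -> 0 < f s).
  by left.
move=> not_gt0; right; pose Z := [set s | a <= s <= b /\ f s = 0].
have [z Zz] : Z !=set0.
  apply: contra_notP not_gt0 => noZ s a_s sb; rewrite lt_neqAle f0// andbT.
  by apply/eqP => fs; apply: noZ; exists s; rewrite /Z/= a_s sb.
have Zub : has_ubound Z by exists b => s [/andP[]].
have Zs : has_sup Z by split => //; exists z.
pose r := sup Z; have zr : z <= r by exact: ub_le_sup.
have ar : a <= r by apply: le_trans zr; case: Zz => /andP[].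
have rb : r <= b by apply: ge_sup; [exists z|move=> s [/andP[]]].
have gt0 s : r < s -> s <= b -> 0 < f s.
  move=> rs sb; have a_s : a <= s := le_trans ar (ltW rs).
  rewrite lt_neqAle f0// andbT; apply/eqP => fs.
  have : s <= r by apply: ub_le_sup => //; rewrite /Z/= a_s sb.
  by rewrite leNgt rs.
exists r; split => //; apply/eqP; rewrite eq_le f0// andbT leNgt; apply/negP => fr.
have Dr : [set` `[a, b]] r by rewrite /= in_itv/= ar.
have [d d0 near_r] := within_continuous_dist fc Dr fr.
have [s Zs' rs] := sup_adherent d0 Zs.
have sr : s <= r by exact: ub_le_sup.
case: Zs' => asb fs; have := near_r s; rewrite /= in_itv/= => /(_ asb).
rewrite fs sub0r normrN (gtr0_norm fr) ltxx => H; suff: false by [].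
by apply: H; rewrite ler0_norm -/r in rs *; lra.
Qed.

Lemma within_continuous_le_left (D : set R) f (a b c : R) : a < b ->
  `[a, b] `<=` D -> {within D, continuous f} ->
  (forall s, a <= s -> s < b -> f s <= c) -> f b <= c.
Proof.
move=> ab subD fc f_le; rewrite leNgt; apply/negP => cf.
have fc0 : 0 < f b - c by rewrite subr_gt0.
have Db : D b by apply: subD; rewrite /= in_itv/= lexx ltW.
have [d d0 near_b] := within_continuous_dist fc Db fc0.
pose s := Num.max a (b - d / 2).
have as_ : a <= s by rewrite /s le_max lexx.
have sb : s < b by rewrite /s gt_max ab/=; lra.
have bds : b - d / 2 <= s by rewrite /s le_max lexx orbT.
have Ds : D s by apply: subD; rewrite /= in_itv/= as_ ltW.
have := near_b s Ds; rewrite ltr0_norm; last by rewrite subr_lt0.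
have := f_le s as_ sb => fs; rewrite ler0_norm; last lra.
have sd : - (s - b) < d by lra.
by move=> /(_ sd); lra.
Qed.

Lemma within_continuous_itvS f a b c d : c <= a -> b <= d ->
  {within `[c, d], continuous f} -> {within `[a, b], continuous f}.
Proof.
move=> ca bd; apply: continuous_subspaceW => x /=; rewrite !in_itv/=.
by move=> /andP[ax xb]; rewrite (le_trans ca)//= (le_trans xb).
Qed.

End Continuity.

Section Comparison.
Variables (R : realType) (N : nat) (A Q1 Q2 : 'M[R]_N) (T : R).
Variables (xi1 xi2 : 'I_N -> R) (w x1 x2 l1 l2 : 'I_N -> R -> R).
Hypothesis T_ge0 : 0 <= T.
Hypothesis Q_le : forall i j, 0 <= Q2 i j <= Q1 i j.
Hypothesis xi_le : forall i, xi1 i <= xi2 i.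
Hypothesis w0 : forall i, w i 0 = 0.
Hypothesis l10 : forall i, l1 i 0 = 0.
Hypothesis l20 : forall i, l2 i 0 = 0.
Hypothesis x1_cont : forall i, {within `[0, T], continuous (x1 i)}.
Hypothesis x2_cont : forall i, {within `[0, T], continuous (x2 i)}.
Hypothesis l1_cont : forall i, {within `[0, T], continuous (l1 i)}.
Hypothesis l2_cont : forall i, {within `[0, T], continuous (l2 i)}.
Hypothesis x1_ge0 : forall i (t : R), 0 <= t -> t <= T -> 0 <= x1 i t.
Hypothesis x2_ge0 : forall i (t : R), 0 <= t -> t <= T -> 0 <= x2 i t.
Hypothesis l1_nd : forall i (s t : R), 0 <= s -> s <= t -> t <= T -> l1 i s <= l1 i t.
Hypothesis l2_nd : forall i (s t : R), 0 <= s -> s <= t -> t <= T -> l2 i s <= l2 i t.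
Hypothesis x1E : forall i (t : R), 0 <= t -> t <= T ->
  x1 i t = xi1 i + w i t - \sum_j Q1 i j * l1 j t + l1 i t.
Hypothesis x2E : forall i (t : R), 0 <= t -> t <= T ->
  x2 i t = xi2 i + w i t - \sum_j Q2 i j * l2 j t + l2 i t.
Hypothesis l1_flat : forall i (a b : R), 0 <= a -> a <= b -> b <= T ->
  (forall s, a < s -> s <= b -> 0 < x1 i s) -> l1 i b = l1 i a.
Hypothesis l2_flat : forall i (a b : R), 0 <= a -> a <= b -> b <= T ->
  (forall s, a < s -> s <= b -> 0 < x2 i s) -> l2 i b = l2 i a.
Let K s := active A Q2 [set i | x2 i s == 0]%SET.
Hypothesis l2_active : forall i (a b : R), 0 <= a -> a <= b -> b <= T ->
  (forall s, a < s -> s <= b -> i \notin K s) -> l2 i b = l2 i a.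
Hypothesis subcritical : forall s : R, 0 <= s -> s <= T ->
  exists u, strict_supersolution Q2 (K s) u.

Let D i t := l2 i t - l1 i t.

(** The driving path cancels, and [Q1] may be replaced by [Q2] because it multiplies increments of
    the nondecreasing [l1]. This is the sense in which [l1] is a supersolution for [Q2]. *)
Let x_diff i a b : 0 <= a -> a <= b -> b <= T ->
  (x1 i b - x2 i b) - (x1 i a - x2 i a) <=
  - (D i b - D i a) + \sum_j Q2 i j * (D j b - D j a).
Proof.
move=> a0 ab bT; have b0 := le_trans a0 ab; have aT := le_trans ab bT.
rewrite !x1E// !x2E// /D.
have : \sum_j Q2 i j * (l1 j b - l1 j a) <= \sum_j Q1 i j * (l1 j b - l1 j a).
  apply: ler_sum => j _; rewrite ler_wpM2r ?subr_ge0 ?l1_nd//.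
  by case/andP: (Q_le i j).
have -> : \sum_j Q2 i j * (l2 j b - l1 j b - (l2 j a - l1 j a)) =
    \sum_j Q2 i j * l2 j b - \sum_j Q2 i j * l2 j a -
    \sum_j Q2 i j * (l1 j b - l1 j a).
  by rewrite -!sumrB; apply: eq_bigr => j _; ring.
have -> : \sum_j Q1 i j * (l1 j b - l1 j a) =
    \sum_j Q1 i j * l1 j b - \sum_j Q1 i j * l1 j a.
  by rewrite -!sumrB; apply: eq_bigr => j _; ring.
by lra.
Qed.

(* [r] is the last zero of [x1 i] in [[sg, s]], or [sg] if there is none. *)
Let last_below i sg s : 0 <= sg -> sg <= s -> s <= T -> x1 i sg <= x2 i sg ->
  exists r, [/\ sg <= r, r <= s, x1 i r <= x2 i r & l1 i s = l1 i r].
Proof.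
move=> sg0 sgs sT x12.
have x1c := within_continuous_itvS sg0 sT (@x1_cont i).
have x1p y : sg <= y -> y <= s -> 0 <= x1 i y.
  by move=> sgy ys; rewrite x1_ge0 ?(le_trans sg0)// (le_trans ys).
have [x1_gt0|[r [sgr rs x1r x1_gt0]]] := continuous_last_zero sgs x1c x1p.
  exists sg; split => //; apply: l1_flat => // y sgy ys.
  by apply: x1_gt0 => //; exact: ltW.
have r0 := le_trans sg0 sgr; exists r; split => //.
  by rewrite x1r x2_ge0// (le_trans rs).
exact: l1_flat.
Qed.

Section Local.
Variables (sg ro : R) (u : 'I_N -> R).
Hypotheses (sg0 : 0 <= sg) (sgro : sg <= ro) (roT : ro <= T).
Hypothesis x12 : forall i, x1 i sg <= x2 i sg.
Hypothesis u_super : strict_supersolution Q2 (K sg) u.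
Hypothesis x2_pos : forall i (s : R), 0 < x2 i sg -> sg <= s -> s <= ro -> 0 < x2 i s.

Let u_gt0 i : 0 < u i. Proof. by case: u_super. Qed.

(** On [[sg, ro]] every zero of [x2] is a node that was already zero at [sg], so by monotonicity the
    active set stays inside [K sg]. *)
Let inactive_flat i a b : i \notin K sg -> sg <= a -> a <= b -> b <= ro ->
  l2 i b = l2 i a.
Proof.
move=> iK sga ab bro; apply: l2_active => //.
- exact: le_trans sga.
- exact: le_trans roT.
move=> s a_s sb; apply: contra iK; apply/fintype.subsetP; apply: active_mono.
apply/fintype.subsetP => j; rewrite !inE => /eqP x2s.
have sgs : sg <= s by rewrite (le_trans sga)// ltW.
have sro : s <= ro := le_trans sb bro.
rewrite eq_le x2_ge0// ?(le_trans sgro)// andbT leNgt; apply/negP => x2j.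
by have := x2_pos x2j sgs sro; rewrite x2s ltxx.
Qed.

Let D_inactive i a b : i \notin K sg -> sg <= a -> a <= b -> b <= ro ->
  D i b - D i a <= 0.
Proof.
move=> iK sga ab bro; rewrite /D (inactive_flat iK sga ab bro).
have := @l1_nd i a b (le_trans sg0 sga) ab (le_trans bro roT).
by lra.
Qed.

(** All subintervals are covered at once, since the improvement step trades [[a, b]] for an interval
    [[r0, r]] that may start before [a]. *)
Let D_bound m := forall i a b, sg <= a -> a <= b -> b <= ro ->
  D i b - D i a <= m * u i.

(* For an active node [i], go back from [b] to the last zero [r] of [x2 i], and
   from [a] to [r0]: there [x1 i r0 <= x2 i r0], while [x2 i r <= x1 i r]. *)
Let D_improve m i a b : 0 <= m -> D_bound m ->
  sg <= a -> a <= b -> b <= ro ->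
  D i b - D i a <= Num.max 0 (m * \sum_(j in K sg) Q2 i j * u j).
Proof.
move=> m0 Dm sga ab bro; rewrite le_max; apply/orP.
have a0 := le_trans sg0 sga; have bT := le_trans bro roT.
have aT := le_trans ab bT; have b0 := le_trans a0 ab.
have x2c := within_continuous_itvS a0 bT (@x2_cont i).
have x2p y : a <= y -> y <= b -> 0 <= x2 i y.
  by move=> ay yb; rewrite x2_ge0 ?(le_trans a0)// (le_trans yb).
have l1ab := l1_nd i a0 ab bT.
have [x2_gt0|[r [ar rb x2r x2_gt0]]] := continuous_last_zero ab x2c x2p.
  left; rewrite /D (@l2_flat i a b)//; last first.
    by move=> s a_s sb; apply: x2_gt0 => //; exact: ltW.
  by lra.
right.
have [r0 [sgr0 r0a x12r0 l1a]] := last_below sg0 sga aT (x12 i).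
have r00 := le_trans sg0 sgr0; have r_0 := le_trans a0 ar.
have r0r := le_trans r0a ar; have rT := le_trans rb bT.
have rro := le_trans rb bro.
have l2b : l2 i b = l2 i r by apply: l2_flat.
have l1rb := l1_nd i r_0 rb bT.
have l2r0a := l2_nd i r00 r0a aT.
have x1r : 0 <= x1 i r by exact: x1_ge0.
have := x_diff i r00 r0r rT; rewrite x2r => xd.
(* Flatness and monotonicity give [D i b - D i a <= D i r - D i r0]. As [x1 i - x2 i] is nonpositive
   at [r0] and nonnegative at [r], [x_diff] bounds the latter by this sum. *)
apply: le_trans (_ : \sum_j Q2 i j * (D j r - D j r0) <= _).
  by move: xd; rewrite /D in l1a l2b *; rewrite l2b l1a; lra.
rewrite (bigID (mem (K sg)))/= -[leRHS]addr0; apply: lerD.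
  rewrite mulr_sumr; apply: ler_sum => j _; rewrite mulrCA ler_wpM2l ?Dm//.
  by case/andP: (Q_le i j).
apply: sumr_le0 => j jK; apply: mulr_ge0_le0; first by case/andP: (Q_le i j).
exact: D_inactive.
Qed.

(** The infimum [m] of the admissible constants is admissible, and so is [th * m] with [th < 1];
    hence [m = 0]. Admissible constants exist because the total growth of [l2] on [[sg, ro]] is
    finite. *)
Let D_bound0 : D_bound 0.
Proof.
have [e e0 e_lt] : exists2 e, 0 < e & forall i, u i * e <
    (if i \in K sg then u i - \sum_(j in K sg) Q2 i j * u j else 1).
  apply: exists_small_scale => i; case: ifP => // iK; rewrite subr_gt0.
  by apply u_super.2.
(* [e] may exceed one, hence the truncation at zero. *)
pose th := Num.max 0 (1 - e).
have th_lt1 : th < 1 by rewrite /th gt_max ltr01 ltrBlDr ltrDl.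
have improve m : 0 <= m -> D_bound m -> D_bound (th * m).
  move=> m0 Dm i a b sga ab bro.
  have th0 : 0 <= th by rewrite /th le_max lexx.
  have [iK|iK] := boolP (i \in K sg); last first.
    by apply: le_trans (D_inactive iK sga ab bro) _; rewrite !mulr_ge0// ltW.
  apply: le_trans (D_improve i m0 Dm sga ab bro) _.
  rewrite ge_max !mulr_ge0 ?(ltW (u_gt0 i))//=.
  have -> : th * m * u i = m * (th * u i) by ring.
  rewrite ler_wpM2l//; apply: le_trans (_ : (1 - e) * u i <= _); last first.
    by rewrite ler_wpM2r ?(ltW (u_gt0 i))// /th le_max lexx orbT.
  by have := e_lt i; rewrite iK; lra.
pose M := [set m | 0 <= m /\ D_bound m].
have [m1 Mm1] : M !=set0.
  have l2ro i : 0 <= l2 i ro - l2 i sg by rewrite subr_ge0 l2_nd.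
  exists (\sum_i (l2 i ro - l2 i sg) / u i); split.
    by apply: sumr_ge0 => i _; rewrite divr_ge0// ltW.
  move=> i a b sga ab bro; rewrite mulr_suml (bigD1 i)//= divfK ?gt_eqF//.
  rewrite -[leLHS]addr0; apply: lerD; last first.
    by apply: sumr_ge0 => j _; rewrite mulr_ge0 ?divr_ge0// ltW.
  have a0 := le_trans sg0 sga; have bT := le_trans bro roT.
  have aT := le_trans ab bT.
  have := l2_nd i sg0 sga aT; have := l2_nd i (le_trans a0 ab) bro roT.
  by have := l1_nd i a0 ab bT; rewrite /D; lra.
have Mlb : has_lbound M by exists 0 => m [].
pose m := inf M; have m0 : 0 <= m by apply: lb_le_inf; [exists m1|move=> ? []].
have Dm : D_bound m.
  move=> i a b sga ab bro; rewrite -ler_pdivrMr//.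
  by apply: lb_le_inf; [exists m1|move=> ? [_ /(_ i a b)]; rewrite ler_pdivrMr//; exact].
have : m <= th * m.
  apply: ge_inf => //; split; last exact: improve.
  by rewrite mulr_ge0// /th le_max lexx.
move: m0; rewrite le_eqVlt => /predU1P[m0|m0]; first by rewrite -m0 in Dm.
by rewrite -[leLHS]mul1r ler_pM2r// leNgt th_lt1.
Qed.

(** The order of [x1] and [x2] follows from that of the increments: after the last zero of [x1 i],
    [l1 i] is frozen while [l2 i] can only push [x2 i] up. *)
Lemma local_comparison i : (forall a b, sg <= a -> a <= b -> b <= ro -> D i b <= D i a) /\
  forall t, sg <= t -> t <= ro -> x1 i t <= x2 i t.
Proof.
have D_ni j a b : sg <= a -> a <= b -> b <= ro -> D j b - D j a <= 0.
  by move=> sga ab bro; have := D_bound0 j sga ab bro; rewrite mul0r.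
split=> [a b sga ab bro|t sgt tro]; first by rewrite -subr_le0 D_ni.
have tT := le_trans tro roT.
have [r [sgr rt x12r l1t]] := last_below sg0 sgt tT (x12 i).
have r0 := le_trans sg0 sgr.
have := x_diff i r0 rt tT; have := l2_nd i r0 rt tT.
suff : \sum_j Q2 i j * (D j t - D j r) <= 0 by rewrite /D l1t; lra.
apply: sumr_le0 => j _; apply: mulr_ge0_le0; first by case/andP: (Q_le i j).
exact: D_ni.
Qed.

End Local.

Let P (sg : R) := forall i, (forall a b, 0 <= a -> a <= b -> b <= sg -> D i b <= D i a) /\
  forall t, 0 <= t -> t <= sg -> x1 i t <= x2 i t.

Let P_step (sg : R) : 0 <= sg -> sg < T -> P sg ->
  exists ro, [/\ sg < ro, ro <= T & P ro].
Proof.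
move=> sg0 sgT Psg; have x12 i : x1 i sg <= x2 i sg by apply: (Psg i).2.
have [u u_super] := subcritical sg0 (ltW sgT).
have /choice[d dP] : forall i, exists d, 0 < d /\ forall s, sg <= s -> s < sg + d ->
    s <= T -> 0 < x2 i sg -> 0 < x2 i s.
  move=> i; have [x2i|x2i] := ltP 0 (x2 i sg); last by exists 1; split.
  have Dsg : [set` `[0, T]] sg by rewrite /= in_itv/= sg0 ltW.
  have [d d0 near_sg] := within_continuous_dist (@x2_cont i) Dsg x2i.
  exists d; split => // s sgs ssg sT _.
  have Ds : [set` `[0, T]] s by rewrite /= in_itv/= (le_trans sg0).
  have := near_sg s Ds; rewrite ger0_norm ?subr_ge0// ltrBlDl => /(_ ssg).
  by rewrite ltr_norml => /andP[+ _]; rewrite ltrBrDr addNr.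
(* With all coefficients equal to one this is a positive lower bound of the finitely many [d i]. *)
have [e e0 e_lt] := exists_small_scale (fun=> 1) (fun i => (dP i).1).
pose ro := Num.min T (sg + e).
have sgro : sg < ro by rewrite /ro lt_min sgT ltrDl.
have roT : ro <= T by rewrite /ro ge_min lexx.
have x2_pos i s : 0 < x2 i sg -> sg <= s -> s <= ro -> 0 < x2 i s.
  move=> x2i sgs sro; apply: (dP i).2 => //; last exact: le_trans roT.
  have := e_lt i; rewrite mul1r => ei; apply: le_lt_trans sro _.
  by rewrite /ro gt_min ltrD2l ei orbT.
have L := local_comparison sg0 (ltW sgro) roT x12 u_super x2_pos.
exists ro; split => // i; split=> [a b a0 ab bro|t t0 tro].
  have [bsg|sgb] := leP b sg; first exact: (Psg i).1.
  have [asg|sga] := leP a sg; last by apply: (L i).1 => //; exact: ltW.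
  apply: le_trans (_ : D i sg <= _); last exact: (Psg i).1.
  by apply: (L i).1 => //; exact: ltW.
have [tsg|sgt] := leP t sg; first exact: (Psg i).2.
by apply: (L i).2 => //; exact: ltW.
Qed.

Lemma pathwise_comparison i :
  (forall a b, 0 <= a -> a <= b -> b <= T -> l2 i b - l2 i a <= l1 i b - l1 i a) /\
  forall t, 0 <= t -> t <= T -> x1 i t <= x2 i t.
Proof.
suff PT : P T.
  split; last exact: (PT i).2.
  by move=> a b a0 ab bT; have := (PT i).1 a b a0 ab bT; rewrite /D; lra.
have P0 : P 0.
  move=> j; have eq0 (t : R) : 0 <= t -> t <= 0 -> t = 0.
    by move=> t0 t1; apply/eqP; rewrite eq_le t0 t1.
  split=> [a b a0 ab b0|t t0 t1].
    have bE := eq0 b (le_trans a0 ab) b0; have aE := eq0 a a0 (le_trans ab b0).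
    by rewrite aE bE.
  rewrite (eq0 t t0 t1) x1E// x2E// w0 l10 l20 !addr0 !big1 ?subr0// => k _.
    by rewrite l20 mulr0.
  by rewrite l10 mulr0.
pose S := [set s | [/\ 0 <= s, s <= T & P s]].
have S0 : S 0 by split.
have Sub : has_ubound S by exists T => s [].
have Ss : has_sup S by split => //; exists 0.
pose sg := sup S; have sg0 : 0 <= sg by exact: ub_le_sup.
have sgT : sg <= T by apply: ge_sup; [exists 0|move=> s []].
have P_lt s : s < sg -> exists2 r, s < r & P r.
  rewrite -subr_gt0 => /(sup_adherent)/(_ Ss)[r [_ _ Pr]].
  by rewrite subKr => sr; exists r.
have x_diffc j : {within `[0, T], continuous (fun t => x1 j t - x2 j t)}.
  apply/subspace_continuousP => t Dt; apply: cvgB.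
    by move/subspace_continuousP : (@x1_cont j); apply.
  by move/subspace_continuousP : (@x2_cont j); apply.
have Dc j : {within `[0, T], continuous (D j)}.
  apply/subspace_continuousP => t Dt; apply: cvgB.
    by move/subspace_continuousP : (@l2_cont j); apply.
  by move/subspace_continuousP : (@l1_cont j); apply.
have subT a : 0 <= a -> `[a, sg] `<=` `[0, T].
  move=> a0 t /=; rewrite !in_itv/= => /andP[at_ tsg].
  by rewrite (le_trans a0)//= (le_trans tsg).
have Psg : P sg.
  move=> j; split=> [a b a0 ab bsg|t t0 tsg].
    move: bsg; rewrite le_eqVlt => /predU1P[bE|/P_lt[r br Pr]]; last first.
      by apply: (Pr j).1 => //; exact: ltW.
    move: ab; rewrite bE le_eqVlt => /predU1P[->//|ab].
    apply: (within_continuous_le_left ab (subT _ a0) (Dc j)) => s a_s /P_lt[r sr Pr].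
    by apply: (Pr j).1 => //; exact: ltW.
  move: tsg; rewrite le_eqVlt => /predU1P[tE|/P_lt[r tr Pr]]; last first.
    by apply: (Pr j).2 => //; exact: ltW.
  rewrite tE; move: sg0; rewrite le_eqVlt => /predU1P[<-|sg_gt0].
    exact: (P0 j).2.
  rewrite -subr_le0.
  apply: (within_continuous_le_left sg_gt0 (subT _ (lexx 0)) (x_diffc j)).
  move=> s s0 /P_lt[r sr Pr]; rewrite subr_le0.
  by apply: (Pr j).2 => //; exact: ltW.
move: (sgT); rewrite le_eqVlt => /predU1P[<-//|sg_lt].
have [ro [sgro roT Pro]] := P_step sg0 sg_lt Psg.
have : ro <= sg by apply: ub_le_sup => //; split => //; rewrite (le_trans sg0)// ltW.
by rewrite leNgt sgro.
Qed.

End Comparison.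

(** * Normal probabilities of intervals *)

Section NormalEstimates.
Variable R : realType.
Implicit Types s : R.

Let mu := @lebesgue_measure R.

Lemma normal_peak_scale s : 0 < s -> normal_peak s = s^-1 * (Num.sqrt (pi *+ 2))^-1.
Proof.
move=> s0; rewrite /normal_peak -mulrnAr sqrtrM ?sqr_ge0//.
by rewrite sqrtr_sqr gtr0_norm// invfM.
Qed.

Let measurable_EFin_pdf s (D : set (measurableTypeR R)) :
  measurable_fun D (EFin \o normal_pdf 0 s).
Proof.
by apply: measurable_funTS; apply/measurable_EFinP; exact: measurable_normal_pdf.
Qed.

Lemma normal_prob_interval_le (s a : R) : 0 < s -> 0 <= a ->
  (normal_prob 0 s `[(- a)%R, a%R] <= (2 * a / s)%:E)%E.
Proof.
move=> s0 a0; rewrite /normal_prob.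
apply: (@le_trans _ _ (\int[mu]_(x in `[(- a)%R, a%R]) (normal_peak s)%:E)%E).
  apply: ge0_le_integral => //.
  - by move=> x _; rewrite lee_fin normal_pdf_ge0.
  - exact: measurable_EFin_pdf.
  - by move=> x _; rewrite lee_fin normal_pdf_ub// gt_eqF.
rewrite integral_cst//= /mu lebesgue_measure_itv/= lte_fin.
case: ifPn => [_|]; last by rewrite mule0 lee_fin divr_ge0 ?mulr_ge0// ltW.
rewrite -EFinB -EFinM lee_fin normal_peak_scale// opprK.
have k1 : (Num.sqrt (pi *+ 2))^-1 <= 1 :> R.
  rewrite invf_le1; last by rewrite sqrtr_gt0 mulrn_wgt0// pi_gt0.
  rewrite -[leLHS]sqrtr1 ler_wsqrtr//; have := @pi_ge2 R.
  by rewrite mulr2n; lra.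
have -> : 2 * a / s = s^-1 * 1 * (a + a) by ring.
apply: ler_wpM2r; first by rewrite addr_ge0.
by apply: ler_wpM2l => //; rewrite invr_ge0 ltW.
Qed.

(** Between [- 2 s] and [- s] the density is at least [exp (- 2)] times its peak, and the length [s]
    cancels the factor [1 / s] of the peak: [c] does not depend on [s]. *)
Lemma normal_prob_lower_ray : exists2 c : R, 0 < c &
  forall s, 0 < s -> (c%:E <= normal_prob 0 s `]-oo, (- s)%R[)%E.
Proof.
exists (expR (- 2) * (Num.sqrt (pi *+ 2))^-1).
  by rewrite mulr_gt0 ?expR_gt0// invr_gt0 sqrtr_gt0 mulrn_wgt0// pi_gt0.
move=> s s0; rewrite /normal_prob.
have sub : `]-(2 * s), (- s)[ `<=` `]-oo, (- s)[.
  by move=> x /=; rewrite !in_itv/= => /andP[].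
apply: (@le_trans _ _ (\int[mu]_(x in `](- (2 * s))%R, (- s)%R[)
    (normal_peak s * expR (- 2))%:E)%E).
  rewrite integral_cst//= /mu lebesgue_measure_itv/= lte_fin.
  have -> : - (2 * s) < - s by lra.
  rewrite -EFinB -EFinM lee_fin normal_peak_scale//.
  rewrite (_ : - s - - (2 * s) = s); last by ring.
  rewrite le_eqVlt; apply/orP; left; apply/eqP; field.
  by rewrite (gt_eqF s0) gt_eqF// sqrtr_gt0 mulrn_wgt0// pi_gt0.
have sub_le : (\int[mu]_(x in `](- (2 * s))%R, (- s)%R[) (normal_pdf 0 s x)%:E <=
    \int[mu]_(x in `]-oo, (- s)%R[) (normal_pdf 0 s x)%:E)%E.
  apply: ge0_subset_integral => //; first exact: measurable_EFin_pdf.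
  by move=> x _; rewrite lee_fin normal_pdf_ge0.
apply: le_trans sub_le.
apply: ge0_le_integral => //.
- by move=> x _; rewrite lee_fin mulr_ge0 ?expR_ge0 ?normal_peak_ge0.
- exact: measurable_EFin_pdf.
- move=> x /=; rewrite in_itv/= => /andP[lx ux].
  rewrite lee_fin normal_pdfE ?gt_eqF//= ler_wpM2l ?normal_peak_ge0//.
  rewrite /normal_fun ler_expR subr0 mulNr lerN2 ler_pdivrMr; last first.
    by rewrite mulrn_wgt0// exprn_gt0.
  have : x ^+ 2 <= (2 * s) ^+ 2.
    by rewrite -[x ^+ 2]sqrrN ler_pXn2r// ?nnegrE; lra.
  by rewrite exprMn mulr2n; lra.
Qed.

(* On this ray the density of standard deviation [s] is at most
   [2 exp (- 3 M ^ 2 / 8)] times the density of standard deviation [2 s]. *)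
Lemma normal_prob_upper_ray (eta : R) : 0 < eta -> exists2 M : R, 0 < M &
  forall s, 0 < s -> (normal_prob 0 s `](M * s)%R, +oo[ <= eta%:E)%E.
Proof.
move=> eta0; have e16 : 0 < 16 / eta by rewrite divr_gt0.
(* [M] is at least [1] and [16 / eta], so [M ^ 2 >= 16 / eta] and [exp (3 M ^ 2 / 8) >= 6 / eta],
   more than the [2 / eta] required. *)
pose M := 1 + 16 / eta; have M0 : 0 < M by rewrite /M addr_gt0.
have MM : 16 / eta <= M ^+ 2.
  by rewrite expr2; apply: (@le_trans _ _ (M * 1)); rewrite /M; nra.
exists M => // s s0; pose K := 2 * expR (- (3 / 8 * M ^+ 2)).
have K0 : 0 <= K by rewrite mulr_ge0 ?expR_ge0.
have K_eta : K <= eta.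
  rewrite /K expRN ler_pdivrMr ?expR_gt0//.
  have := expR_ge1Dx (3 / 8 * M ^+ 2) => h.
  apply: le_trans (_ : eta * (16 / eta * (3 / 8)) <= _).
    have -> : eta * (16 / eta * (3 / 8)) = 6 by field; rewrite gt_eqF.
    by lra.
  by rewrite ler_pM2l//; lra.
apply: le_trans (_ : (K%:E * normal_prob 0 (2 * s) `](M * s)%R, +oo[ <= _)%E); last first.
  apply: (@le_trans _ _ (K%:E * 1)%E); last by rewrite mule1 lee_fin.
  by apply: lee_wpmul2l; rewrite ?lee_fin// probability_le1.
rewrite /normal_prob -ge0_integralZl//; last 2 first.
- exact: measurable_EFin_pdf.
- by move=> x _; rewrite lee_fin normal_pdf_ge0.
apply: ge0_le_integral => //.
- by move=> x _; rewrite lee_fin normal_pdf_ge0.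
- exact: measurable_EFin_pdf.
- by apply: measurable_funeM; exact: measurable_EFin_pdf.
move=> x /=; rewrite in_itv/= andbT => xM; rewrite -EFinM lee_fin.
have s2 : 0 < 2 * s by rewrite mulr_gt0.
rewrite !normal_pdfE ?gt_eqF//= !normal_peak_scale// /normal_fun !subr0.
rewrite /K; set k := (Num.sqrt _)^-1.
have k0 : 0 <= k by rewrite invr_ge0 sqrtr_ge0.
have -> : 2 * expR (- (3 / 8 * M ^+ 2)) *
    ((2 * s)^-1 * k * expR (- x ^+ 2 / ((2 * s) ^+ 2 *+ 2))) =
  s^-1 * k * (expR (- (3 / 8 * M ^+ 2)) * expR (- x ^+ 2 / ((2 * s) ^+ 2 *+ 2))).
  by field; rewrite gt_eqF.
apply: ler_wpM2l; first by rewrite mulr_ge0// invr_ge0 ltW.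
rewrite -expRD ler_expR.
have -> : - x ^+ 2 / (s ^+ 2 *+ 2) =
    - (3 / 8 * (x ^+ 2 / s ^+ 2)) - x ^+ 2 / ((2 * s) ^+ 2 *+ 2).
  by field; rewrite gt_eqF.
rewrite mulNr lerD2r lerN2 ler_wpM2l// ler_pdivlMr ?exprn_gt0// -exprMn.
have Ms : 0 <= M * s by rewrite mulr_ge0// ltW.
by rewrite ler_pXn2r ?nnegrE// ltW// (le_lt_trans Ms).
Qed.

End NormalEstimates.

(** * Independence of the increments from the filtration *)

Section Generated.
Context {d : measure_display} {T : measurableType d} {R : realType}.
Implicit Types (G H : set (set T)).

Lemma g_sigma_setI G A B : <<s G >> A -> <<s G >> B -> <<s G >> (A `&` B).
Proof. exact: (@measurableI _ (g_sigma_algebraType G)). Qed.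

Lemma g_sigma_setC G A : <<s G >> A -> <<s G >> (~` A).
Proof. exact: (@measurableC _ (g_sigma_algebraType G)). Qed.

Lemma g_sigma_setT G : <<s G >> [set: T].
Proof. exact: (@measurableT _ (g_sigma_algebraType G)). Qed.

Lemma g_sigma_sub G H : G `<=` <<s H >> -> <<s G >> `<=` <<s H >>.
Proof. by apply: smallest_sub; exact: smallest_sigma_algebra. Qed.

Lemma g_sigma_measurable G :
  G `<=` @measurable _ T -> <<s G >> `<=` @measurable _ T.
Proof. by apply: smallest_sub; exact: sigma_algebra_measurable. Qed.

Lemma events_measurable (J : Type) (D : set J) (Y : J -> T -> R) :
  (forall j, D j -> measurable_fun setT (Y j)) ->
  events D Y `<=` @measurable _ T.
Proof. by move=> mY _ [j Dj [B mB <-]]; exact: mY. Qed.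

Lemma events_measurable_fun (J : Type) (D : set J) (Y : J -> T -> R)
    (G : set (set T)) j : events D Y `<=` <<s G >> -> D j ->
  measurable_fun setT (Y j : g_sigma_algebraType G -> R).
Proof.
move=> DYG Dj _ B mB; apply: DYG; exists j => //.
by exists B.
Qed.

Lemma events_sub (J K : Type) (D : set J) (E : set K) (Y : J -> T -> R)
    (Z : K -> T -> R) : (forall j, D j -> exists2 k, E k & Y j = Z k) ->
  events D Y `<=` events E Z.
Proof. by move=> YZ A [j Dj Aj]; have [k Ek YZj] := YZ j Dj; exists k; rewrite -?YZj. Qed.

(** For fixed [B], the finite measures [P (A & B)] and [P A * P B] in the variable [A] agree on the
    pi-system [G], hence on the sigma-algebra it generates. *)
Lemma independent_generated (P : probability T R) G H :
  G `<=` @measurable _ T -> H `<=` @measurable _ T -> setI_closed G -> G setT ->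
  independent P G H -> independent P <<s G >> H.
Proof.
move=> mG mH GI GT ind A B sGA HB.
have mB := mH _ HB.
have PB0 : 0 <= fine (P B) by rewrite fine_ge0.
pose m1 := mrestr P mB; pose m2 := mscale (NngNum PB0) P.
have PBE : ((NngNum PB0)%:num)%:E = P B by rewrite /= fineK// fin_num_measure.
have m2E C : m2 C = (P C * P B)%E by rewrite muleC -PBE.
suff : m1 A = m2 A by move=> m12; exact: etrans m12 (m2E A).
apply: (@g_sigma_algebra_measure_unique _ _ _ G mG (fun=> setT)) => //.
- by rewrite bigcup_const.
- by move=> C GC; exact: etrans (ind _ _ GC HB) (esym (m2E C)).
- move=> _ /=; apply: le_lt_trans (probability_le1 P _) (ltry 1).
  exact: measurableI.
Qed.

End Generated.

Section Increments.
Context {d : measure_display} {T : measurableType d} {R : realType}.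
Variables (P : probability T R) (N : nat) (A : 'M[R]_N) (W : 'I_N -> T -> R -> R).
Variable xi : 'I_N -> T -> R.
Hypothesis W_brownian : brownian P A W.
Hypothesis xi_meas : forall i, measurable_fun setT (xi i).
Hypothesis xi_W_indep : independent P <<s events [set: 'I_N] xi >>
    <<s events [set it : 'I_N * R | 0 <= it.2] (fun it w => W it.1 w it.2) >>.

Let F := filtration xi W.
Let allW := <<s events [set it : 'I_N * R | 0 <= it.2] (fun it w => W it.1 w it.2) >>.

Definition increment (v : 'rV[R]_N) (s t : R) (w : T) : R :=
  \sum_i v 0 i * (W i w t - W i w s).

Let W_meas i t : 0 <= t -> measurable_fun setT (fun w => W i w t).
Proof. by case: W_brownian => _ + _ _ _; exact. Qed.

Lemma filtration_mono (s t : R) : s <= t -> F s `<=` F t.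
Proof.
move=> st; apply: g_sigma_sub => B [xiB|pB]; apply: sub_sigma_algebra.
  by left.
right; move: B pB; apply: events_sub => -[i r] /= /andP[r0 rs].
by exists (i, r) => //=; rewrite r0 (le_trans rs).
Qed.

Lemma filtration_measurable t : F t `<=` @measurable _ T.
Proof.
apply: g_sigma_measurable => B [].
  by apply: events_measurable.
by apply: events_measurable => -[i r] /= /andP[r0 _]; exact: W_meas.
Qed.

Lemma filtration_xi i t :
  measurable_fun setT (xi i : g_sigma_algebraType (events [set: 'I_N] xi `|` past W t) -> R).
Proof.
apply: (@events_measurable_fun _ _ _ _ setT xi) => // B xiB.
by apply: sub_sigma_algebra; left.
Qed.

Lemma filtration_W i (s t : R) : 0 <= s -> s <= t ->
  measurable_fun setT
    ((fun w => W i w s) : g_sigma_algebraType (events [set: 'I_N] xi `|` past W t) -> R).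
Proof.
move=> s0 st; apply: (@events_measurable_fun _ _ _ _ [set iu : 'I_N * R | 0 <= iu.2 <= t]
  (fun iu w => W iu.1 w iu.2) _ (i, s)) => /=; last by rewrite s0.
by move=> B pB; apply: sub_sigma_algebra; right.
Qed.

Lemma increment_filtration v (s t : R) B : 0 <= s -> s <= t -> measurable B ->
  F t (increment v s t @^-1` B).
Proof.
move=> s0 st mB; rewrite -[_ @^-1` _]setTI.
suff : measurable_fun setT (increment v s t :
    g_sigma_algebraType (events [set: 'I_N] xi `|` past W t) -> R).
  by move=> /(_ measurableT B mB).
have t0 := le_trans s0 st.
apply: measurable_sum => i; apply: measurable_funM => //.
by apply: measurable_funB; exact: filtration_W.
Qed.

(* The sets [C `&` D] with [C] in the sigma-algebra of [xi] and [D] in the past of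
   [W] form a pi-system generating the filtration. *)
Lemma filtration_indep (s t : R) : 0 <= s -> s <= t -> independent P (F s)
  <<s events [set: 'I_N] (fun i w => W i w t - W i w s) >>.
Proof.
move=> s0 st; have t0 := le_trans s0 st.
set incr := <<s events _ _ >>.
pose sxi := <<s events [set: 'I_N] xi >>.
pose G := [set B | exists C D, [/\ sxi C, <<s past W s >> D & B = C `&` D]].
have past_allW : <<s past W s >> `<=` allW.
  apply: g_sigma_sub => B pB; apply: sub_sigma_algebra.
  by move: B pB; apply: events_sub => -[i r] /= /andP[r0 rs]; exists (i, r).
have incr_allW : incr `<=` allW.
  apply: g_sigma_sub => B [i _ [C mC <-]].
  suff : measurable_fun setT ((fun w => W i w t - W i w s) : g_sigma_algebraType
      (events [set it : 'I_N * R | 0 <= it.2] (fun it w => W it.1 w it.2)) -> R).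
    by move=> /(_ measurableT C mC).
  apply: measurable_funB.
    apply: (@events_measurable_fun _ _ _ _ [set it : 'I_N * R | 0 <= it.2]
      (fun it w => W it.1 w it.2) _ (i, t)) => //.
  apply: (@events_measurable_fun _ _ _ _ [set it : 'I_N * R | 0 <= it.2]
    (fun it w => W it.1 w it.2) _ (i, s)) => //.
have allW_meas : allW `<=` @measurable _ T.
  by apply: g_sigma_measurable; apply: events_measurable => -[i r] /=; exact: W_meas.
have sxi_meas : sxi `<=` @measurable _ T.
  by apply: g_sigma_measurable; exact: events_measurable.
have FG : F s `<=` <<s G >>.
  apply: g_sigma_sub => B [xiB|pB]; apply: sub_sigma_algebra.
    by exists B, setT; split; [exact: sub_sigma_algebra|exact: g_sigma_setT|rewrite setIT].
  by exists setT, B; split; [exact: g_sigma_setT|exact: sub_sigma_algebra|rewrite setTI].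
suff ind : independent P <<s G >> incr by move=> B C /FG; exact: ind.
apply: independent_generated.
- move=> _ [C [D [sC sD ->]]]; apply: measurableI; first exact: sxi_meas.
  by apply: allW_meas; exact: past_allW.
- by move=> B /incr_allW/allW_meas.
- move=> _ _ [C [D [sC sD ->]]] [C' [D' [sC' sD' ->]]].
  exists (C `&` C'), (D `&` D'); split; [exact: g_sigma_setI..|exact: setIACA].
- by exists setT, setT; split; [exact: g_sigma_setT..|rewrite setIT].
- move=> _ I [C [D [sC sD ->]]] sI.
  have allD := past_allW _ sD; have allI := incr_allW _ sI.
  rewrite -setIA xi_W_indep//; last exact: g_sigma_setI.
  case: W_brownian => _ _ _ + _ => /(_ s t s0 st D I sD sI) ->.
  by rewrite muleA [P (C `&` D)]xi_W_indep.
Qed.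

Lemma increment_indep v (s t : R) (E : set T) (B : set R) : 0 <= s -> s <= t -> F s E ->
  measurable B ->
  P (E `&` increment v s t @^-1` B) =
  (P E * centered_normal ((t - s) * (v *m A *m v^T) 0 0)%R B)%E.
Proof.
move=> s0 st sE mB.
rewrite (filtration_indep s0 st sE); first by case: W_brownian => _ _ _ _ ->.
set G := events _ _.
suff : measurable_fun setT (increment v s t : g_sigma_algebraType G -> R).
  by move=> /(_ measurableT B mB); rewrite setTI.
apply: measurable_sum => i; apply: measurable_funM => //.
apply: (@events_measurable_fun _ _ _ _ setT (fun i w => W i w t - W i w s)) => //.
Qed.

End Increments.

(** * Processes dominated by a Brownian motion do not reach zero *)

Section Survival.
Context {d : measure_display} {T : measurableType d} {R : realType}.
Variables (P : probability T R) (N : nat) (A : 'M[R]_N) (W : 'I_N -> T -> R -> R).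
Variable xi : 'I_N -> T -> R.
Hypothesis W_brownian : brownian P A W.
Hypothesis xi_meas : forall i, measurable_fun setT (xi i).
Hypothesis xi_W_indep : independent P <<s events [set: 'I_N] xi >>
    <<s events [set it : 'I_N * R | 0 <= it.2] (fun it w => W it.1 w it.2) >>.
Variable v : 'rV[R]_N.

Let F := filtration xi W.
Let q := (v *m A *m v^T) 0 0.

Lemma increment_split (s r t : R) w :
  increment W v s t w = increment W v s r w + increment W v r t w.
Proof. by rewrite /increment -big_split/=; apply: eq_bigr => i _; ring. Qed.

Let F_meas t E : F t E -> measurable E.
Proof. by apply: (filtration_measurable W_brownian). Qed.

Let inc_indep := increment_indep W_brownian xi_meas xi_W_indep.

Lemma centered_normal_pos (c : R) B : 0 < c ->
  centered_normal c B = normal_prob 0 (Num.sqrt c) B.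
Proof. by move=> c0; rewrite /centered_normal gt_eqF. Qed.

(** Each step conditions on the past. Membership of the event in [F (t m)] is part of the induction
    because the next increment is independent of such events only. *)
Lemma increment_chain (t : nat -> R) (C : nat -> set R) (rho : R) (E : set T) m :
  0 <= rho -> (forall j, 0 <= t j) -> (forall j, t j <= t j.+1) -> F (t 0%N) E ->
  (forall j, (j < m)%N -> measurable (C j) /\
    (centered_normal ((t j.+1 - t j) * q)%R (C j) <= rho%:E)%E) ->
  let S := [set w | E w /\ forall j, (j < m)%N -> C j (increment W v (t j) (t j.+1) w)] in
  F (t m) S /\ (P S <= (rho ^+ m)%:E * P E)%E.
Proof.
move=> rho0 t0 t_le FE; elim: m => [|m IH] HC /=.
  have -> : [set w | E w /\ forall j, (j < 0)%N -> C j (increment W v (t j) (t j.+1) w)] = E.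
    by apply/seteqP; split => w => [[]|Ew].
  by rewrite expr0 mul1e.
have [FS PS] := IH (fun j jm => HC j (ltnW jm)).
have [mC cC] := HC m (ltnSn m).
have -> : [set w | E w /\ forall j, (j < m.+1)%N -> C j (increment W v (t j) (t j.+1) w)] =
    [set w | E w /\ forall j, (j < m)%N -> C j (increment W v (t j) (t j.+1) w)] `&`
    increment W v (t m) (t m.+1) @^-1` C m.
  apply/seteqP; split => w => [[Ew Hw]|[[Ew Hw] Hm]].
    by split; [split=> // j jm; exact/Hw/ltnW|exact: Hw].
  by split => // j; rewrite ltnS leq_eqVlt => /predU1P[->|/Hw].
split.
  apply: g_sigma_setI; first exact: (filtration_mono (t_le m)).
  exact: increment_filtration.
rewrite inc_indep// exprS EFinM -muleA muleC.
apply: lee_pmul => //.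
rewrite /centered_normal; case: ifP => _ //.
Qed.

Hypothesis q_gt0 : 0 < q.

Definition survival (delta s : R) m (t : nat -> R) : set T :=
  [set w | forall j, (j <= m)%N -> - delta <= increment W v s (s + t j) w].

(* The times grow geometrically, [t (j + 1) = K t j], and [S j] denotes the
   increment over [[s, s + t j]]: if [- delta <= S j] for all [j], then either some
   [S j] is unusually large or no increment [S (j + 1) - S j] falls below minus one
   standard deviation. *)
Lemma increment_survival (eta eps : R) : 0 < eta -> 0 < eps ->
  exists (delta : R) (m : nat) (t : nat -> R),
  [/\ 0 < delta, forall j, (j <= m)%N -> 0 <= t j <= eps &
    forall (s : R) (E : set T), 0 <= s -> F s E ->
    measurable (E `&` survival delta s m t) /\
    (P (E `&` survival delta s m t) <= eta%:E * P E)%E].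
Proof.
move=> eta0 eps0.
have [c c0 cP] := @normal_prob_lower_ray R.
have c1 : c <= 1.
  rewrite -lee_fin; apply: le_trans (cP 1 ltr01) _.
  exact: probability_le1.
have eta20 : 0 < eta / 2 by rewrite divr_gt0.
have [m m_eta] : exists m, (1 - c) ^+ m <= eta / 2.
  have c_lt1 : `|1 - c| < 1 by rewrite ger0_norm ?subr_ge0// ltrBlDr ltrDl.
  have /cvgrPdist_le/(_ (eta / 2)) := cvg_expr c_lt1.
  move=> /(_ eta20)[m _ /(_ m (leqnn m))]/=.
  rewrite sub0r normrN => h; exists m; exact: le_trans (ler_norm _) h.
have m1_gt0 : 0 < m.+1%:R :> R by rewrite ltr0n.
have eta'0 : 0 < eta / 2 / m.+1%:R by rewrite !divr_gt0.
have [M M0 MP] := normal_prob_upper_ray eta'0.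
(* With this ratio the increment from [t j] to [t (j + 1)] has standard deviation [2 * M * sd j]. A
   fall of that size from a level at most [M * sd j] ends below [- M * sd j], hence below [- delta]
   for [delta = M * sd 0]. *)
pose K := 1 + 4 * M ^+ 2.
have K1 : 1 < K by rewrite /K ltrDl mulr_gt0// exprn_gt0.
have K0 : 0 < K by apply: lt_trans K1.
(* Normalized so that the last tested time [t m] is [eps]. *)
pose t (j : nat) := eps * K ^+ j / K ^+ m.
have t_gt0 j : 0 < t j by rewrite /t divr_gt0 ?mulr_gt0 ?exprn_gt0.
have tS j : t j.+1 - t j = (2 * M) ^+ 2 * t j.
  by rewrite /t exprS /K; field; rewrite expf_neq0// gt_eqF.
have t_le j : t j <= t j.+1.
  by rewrite -subr_ge0 tS mulr_ge0 ?sqr_ge0// ltW.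
have t0_le j : t 0%N <= t j.
  by elim: j => // j IH; exact: le_trans (t_le j).
have tq_gt0 j : 0 < t j * q by exact: mulr_gt0.
pose sd j := Num.sqrt (t j * q).
have sd_gt0 j : 0 < sd j by rewrite sqrtr_gt0.
have sd0_le j : sd 0%N <= sd j by rewrite ler_wsqrtr// ler_wpM2r// ltW.
exists (M * sd 0%N), m, t; split.
- by rewrite mulr_gt0.
- move=> j jm; rewrite ltW//= /t ler_pdivrMr ?exprn_gt0//.
  by rewrite ler_pM2l// ler_eXn2l.
move=> s E s0 FE; set S := _ `&` _; have mE := F_meas FE.
have inc_meas u B : 0 <= u -> measurable B -> measurable (increment W v s (s + u) @^-1` B).
  move=> u0 mB; apply: F_meas; apply: increment_filtration => //.
  by rewrite lerDl.
have mS : measurable S.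
  have -> : S = E `&` \bigcap_(j in [set j | (j <= m)%N])
      (increment W v s (s + t j) @^-1` `[- (M * sd 0%N), +oo[).
    apply/seteqP; split => w [Ew Hw]; split => // j /= jm.
      by rewrite in_itv/= Hw.
    by have := Hw j jm; rewrite /= in_itv/= andbT.
  apply: measurableI => //; apply: bigcap_measurable => [|j _].
    by exists 0%N.
  by apply: inc_meas; first exact: ltW.
split => //.
pose big j := E `&` increment W v s (s + t j) @^-1` `](M * sd j)%R, +oo[.
have mbig j : measurable (big j).
  by apply: measurableI => //; apply: inc_meas => //; exact: ltW.
have Pbig j : (P (big j) <= (eta / 2 / m.+1%:R)%:E * P E)%E.
  rewrite /big inc_indep//; last by rewrite lerDl ltW.
  rewrite muleC lee_wpmul2r// addrAC subrr add0r centered_normal_pos//.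
  exact: (MP (sd j)).
pose C j := ~` `]-oo, (- (2 * M * sd j))%R[.
pose G := [set w | E w /\ forall j, (j < m)%N -> C j (increment W v (s + t j) (s + t j.+1) w)].
pose u j := s + t j.
have FuE : F (u 0%N) E by apply: (filtration_mono _ FE); rewrite lerDl ltW.
have [||j|j jm|FG PG] := @increment_chain u C (1 - c) E m _ _ _ FuE.
- by rewrite subr_ge0.
- by move=> j; rewrite addr_ge0// ltW.
- by rewrite lerD2l.
- have mray : measurable `]-oo, (- (2 * M * sd j))%R[ by exact: measurable_itv.
  split; first exact: measurableC.
  have -> : (u j.+1 - u j) * q = (2 * M) ^+ 2 * (t j * q).
    by rewrite mulrA -tS /u; ring.
  rewrite centered_normal_pos; last by rewrite mulr_gt0// exprn_gt0// mulr_gt0.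
  rewrite sqrtrM ?sqr_ge0// sqrtr_sqr gtr0_norm ?mulr_gt0// -/(sd j).
  rewrite probability_setC// EFinB leeB// cP// !mulr_gt0//.
have sub : S `<=` G `|` \big[setU/set0]_(j < m.+1) big j.
  move=> w [Ew Sw]; have [[j [jm bj]]|nbig] := pselect (exists j, (j < m.+1)%N /\ big j w).
    by right; rewrite -bigcup_mkord; exists j.
  left; split=> // j jm; rewrite /C /= in_itv/=; apply/negP; rewrite -leNgt.
  have Sj : increment W v s (s + t j) w <= M * sd j.
    rewrite leNgt; apply/negP => lt_S; apply: nbig; exists j; split; first exact: ltnW.
    by split => //=; rewrite in_itv/= lt_S.
  have := Sw j.+1 jm; rewrite (increment_split s (s + t j)).
  have : M * sd 0%N <= M * sd j by rewrite ler_pM2l.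
  by lra.
have mU : measurable (\big[setU/set0]_(j < m.+1) big j) by exact: bigsetU_measurable.
have mG : measurable G := F_meas FG.
apply: (@le_trans _ _ (P (G `|` \big[setU/set0]_(j < m.+1) big j))).
  by apply: le_measure; rewrite ?inE//; exact: measurableU.
apply: (@le_trans _ _ (P G + P (\big[setU/set0]_(j < m.+1) big j))%E).
  exact: measureU2.
have -> : (eta%:E * P E = (eta / 2)%:E * P E + (eta / 2)%:E * P E)%E.
  by rewrite -ge0_muleDl ?lee_fin ?divr_ge0 ?(ltW eta0)// -EFinD -splitr.
apply: leeD.
  by apply: le_trans PG _; rewrite lee_wpmul2r// lee_fin.
apply: (@le_trans _ _ (\sum_(j < m.+1) P (big j))%E).
  by apply: Boole_inequality.
apply: (@le_trans _ _ (\sum_(j < m.+1) ((eta / 2 / m.+1%:R)%:E * P E))%E).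
  by apply: lee_sum.
rewrite -ge0_sume_distrl; last by move=> j _; rewrite lee_fin ltW.
rewrite sumEFin sumr_const card_ord lee_wpmul2r// lee_fin -[leLHS]mulr_natr divfK//.
Qed.

Section NeverZero.
Variables (U : R -> T -> R) (tau : T -> \bar R).
Hypothesis U_adapted : forall (delta t : R), 0 <= t ->
  F t ([set w | (t%:E < tau w)%E] `&` [set w | U t w <= delta]).
Hypothesis U_ge0 : {ae P, forall w, forall t : R, 0 <= t -> (t%:E < tau w)%E ->
  0 <= U t w}.
Hypothesis U_increment : {ae P, forall w, forall s t : R, 0 <= s -> s <= t ->
  (t%:E < tau w)%E -> U t w - U s w <= increment W v s t w}.
Hypothesis U_small : {ae P, forall w, forall t : R, 0 <= t -> (t%:E < tau w)%E ->
  U t w = 0 -> forall delta : R, 0 < delta -> exists2 e : R, 0 < e &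
  forall s : R, t <= s -> s < t + e -> (s%:E < tau w)%E -> U s w <= delta}.

Let good w := [/\ forall t : R, 0 <= t -> (t%:E < tau w)%E -> 0 <= U t w,
  forall s t : R, 0 <= s -> s <= t ->
  (t%:E < tau w)%E -> U t w - U s w <= increment W v s t w &
  forall t : R, 0 <= t -> (t%:E < tau w)%E ->
  U t w = 0 -> forall delta : R, 0 < delta -> exists2 e : R, 0 < e &
  forall s : R, t <= s -> s < t + e -> (s%:E < tau w)%E -> U s w <= delta].

(** The margin [2 * eps] before [tau] is spent in two halves: the grid point lies within [eps] of
    the zero, and the survival times within [eps] of the grid point. *)
Let hits (eps Tm : R) := [set w | good w /\ exists t : R,
  [/\ 0 <= t, t <= Tm, ((t + 2 * eps)%:E < tau w)%E & U t w = 0]].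

(* Stopping at the first point of a grid where [U <= delta]; as the grid is
   refined, this point eventually precedes [t + eps] when [U] vanishes at [t]. *)
Let hits_small (eps Tm eta : R) : 0 < eps -> 0 <= Tm -> 0 < eta ->
  exists B, [/\ measurable B, (P B <= eta%:E)%E & hits eps Tm `<=` B].
Proof.
move=> eps0 Tm0 eta0.
have [delta [m [t [delta0 t_bound surv]]]] := increment_survival eta0 eps0.
pose g (n i : nat) : R := i%:R / n.+1%:R.
have g0 n i : 0 <= g n i by rewrite divr_ge0.
have g_le n i j : (i <= j)%N -> g n i <= g n j.
  by move=> ij; rewrite ler_wpM2r ?invr_ge0// ler_nat.
pose near n i := [set w | ((g n i)%:E < tau w)%E] `&` [set w | U (g n i) w <= delta].
pose first n i := near n i `&` ~` \big[setU/set0]_(j < i) near n j.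
have F_near n i : F (g n i) (near n i) by exact: U_adapted.
have F_first n i : F (g n i) (first n i).
  apply: g_sigma_setI; first exact: F_near.
  apply: g_sigma_setC.
  rewrite -bigcup_mkord.
  apply: (@fin_bigcup_measurable _ (g_sigma_algebraType _)) => // j /= ji.
  have Fj : F (g n i) (near n j).
    by apply: (filtration_mono _ (F_near n j)); apply: g_le; exact: ltnW.
  exact: Fj.
(* Includes one grid point beyond [Tm], since the one used below is the first strictly after the
   zero [r <= Tm]. *)
pose M n := (Num.truncn (Tm * n.+1%:R)).+2.
pose bad n := \big[setU/set0]_(i < M n) (first n i `&` survival delta (g n i) m t).
have mbad n : measurable (bad n).
  by apply: bigsetU_measurable => i _; exact: (surv (g n i) (first n i) _ _).1.
have Pbad n : (P (bad n) <= eta%:E)%E.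
  apply: (@le_trans _ _ (\sum_(i < M n) P (first n i `&` survival delta (g n i) m t))%E).
    apply: (@Boole_inequality _ _ _ P (fun i => first n i `&` survival delta (g n i) m t)).
    by move=> i _; exact: (surv (g n i) (first n i) _ _).1.
  apply: (@le_trans _ _ (\sum_(i < M n) (eta%:E * P (first n i)))%E).
    by apply: lee_sum => i _; exact: (surv (g n i) (first n i) _ _).2.
  have mfirst i : measurable (first n i) by exact: F_meas (F_first n i).
  rewrite -ge0_sume_distrr// -measure_bigsetU//; last first.
    apply/trivIsetP => i j _ _; wlog ij : i j / (i < j)%N.
      move=> H; rewrite neq_ltn => /orP[|] ij; first by apply: H => //; rewrite ltn_eqF.
      by rewrite setIC; apply: H => //; rewrite ltn_eqF.
    move=> _; rewrite -subset0 => w [[nearj _] [_ nfirst]]; apply: nfirst.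
    by rewrite -bigcup_mkord; exists i.
  apply: (@le_trans _ _ (eta%:E * 1)%E); last by rewrite mule1.
  apply: lee_wpmul2l; first by rewrite lee_fin ltW.
  by apply: probability_le1; exact: bigsetU_measurable.
(* A path in [hits] lies in [bad l] for all large [l], from a rank depending on the path. The limit
   inferior of [bad] thus covers [hits], and its probability is still at most [eta]. *)
pose D n := \bigcap_(l in [set l | (n <= l)%N]) bad l.
have mD n : measurable (D n) by apply: bigcap_measurable => //; exists n => /=.
exists (\bigcup_n D n); split.
- exact: bigcupT_measurable.
- have cvgD : P \o D @ \oo --> P (\bigcup_n D n).
    apply: nondecreasing_cvg_mu => //; first exact: bigcupT_measurable.
    move=> a b ab; apply/subsetPset => w Dw l /= bl; apply: Dw => /=.
    exact: leq_trans bl.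
  rewrite -(cvg_lim _ cvgD)//; apply: lime_le; first by apply/cvg_ex; eexists; exact: cvgD.
  apply: nearW => n /=; apply: le_trans (Pbad n); apply: le_measure; rewrite ?inE//.
  by move=> w /(_ n); apply => /=.
move=> w [[Uge0 Uinc Usm] [r [r0 rT rtau Ur]]].
have rtau' : (r%:E < tau w)%E.
  by apply: le_lt_trans rtau; rewrite lee_fin lerDl mulr_ge0// ltW.
have [e e0 near_r] := Usm r r0 rtau' Ur delta delta0.
pose h := Num.min e eps.
have h0 : 0 < h by rewrite lt_min e0.
have [n n_h] : exists n, forall l, (n <= l)%N -> l.+1%:R^-1 < h.
  exists (Num.truncn h^-1) => l nl; rewrite invf_plt ?posrE//.
  by apply: lt_le_trans (truncnS_gt _) _; rewrite ler_nat ltnS.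
exists n => // l /= nl; have hl := n_h l nl.
have l1 : 0 < l.+1%:R :> R by rewrite ltr0n.
pose i := (Num.truncn (r * l.+1%:R)).+1.
have rl0 : 0 <= r * l.+1%:R by rewrite mulr_ge0// ltW.
have r_lt : r < g l i.
  by rewrite /g ltr_pdivlMr//; exact: truncnS_gt.
have gi_le : g l i <= r + l.+1%:R^-1.
  rewrite /g ler_pdivrMr// mulrDl mulVf ?gt_eqF// -[leLHS]natr1 lerD2r.
  by rewrite truncn_le.
have lt_he : l.+1%:R^-1 < e by apply: lt_le_trans hl _; rewrite ge_min lexx.
have lt_heps : l.+1%:R^-1 < eps by apply: lt_le_trans hl _; rewrite ge_min lexx orbT.
have g_lt_e : g l i < r + e by apply: le_lt_trans gi_le _; rewrite ltrD2l.
have g_lt_eps : g l i < r + eps by apply: le_lt_trans gi_le _; rewrite ltrD2l.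
have near_i : near l i w.
  split => /=; first by apply: le_lt_trans rtau; rewrite lee_fin; lra.
  apply: near_r => //; first exact: ltW.
  by apply: le_lt_trans rtau; rewrite lee_fin; lra.
have ex_near : exists i, `[< near l i w >] by exists i; apply/asboolP.
case: (ex_minnP ex_near) => j /asboolP near_j j_min.
have ji : (j <= i)%N by apply: j_min; apply/asboolP.
have gji := g_le l _ _ ji.
rewrite /bad -(bigcup_mkord _ (fun i => first l i `&` survival delta (g l i) m t)).
exists j => /=.
  by rewrite /M; apply: leq_ltn_trans ji _; rewrite /i !ltnS le_truncn// ler_wpM2r// ltW.
split.
  split => //; rewrite -bigcup_mkord => -[k /= kj near_k].
  by have := j_min k; rewrite leqNgt kj => /(_ (asboolT near_k)).
move=> a am; have /andP[ta0 ta_eps] := t_bound a am.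
have gtau : ((g l j + t a)%:E < tau w)%E.
  by apply: le_lt_trans rtau; rewrite lee_fin; lra.
have gt0 : 0 <= g l j + t a by rewrite addr_ge0.
have gle : g l j <= g l j + t a by rewrite lerDl.
have := Uge0 _ gt0 gtau; have := Uinc _ _ (g0 l j) gle gtau.
by case: near_j => _ /=; lra.
Qed.

Lemma never_zero : {ae P, forall w, forall t : R, 0 <= t -> (t%:E < tau w)%E ->
  U t w != 0}.
Proof.
have hits_null eps Tm : 0 < eps -> 0 <= Tm -> P.-negligible (hits eps Tm).
  move=> eps0 Tm0.
  have /choice[B HB] : forall n : nat, exists B, [/\ measurable B,
      (P B <= (n.+1%:R^-1)%:E)%E & hits eps Tm `<=` B].
    by move=> n; exact: hits_small.
  exists (\bigcap_n B n); split.
  - by apply: bigcapT_measurable => n; case: (HB n).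
  - apply/eqP; rewrite -measure_le0; apply/lee_addgt0Pr => e e0.
    rewrite add0e; have [n n_e] : exists n : nat, n.+1%:R^-1 < e.
      by exists (Num.truncn e^-1); rewrite invf_plt ?posrE// truncnS_gt.
    have [mB PB _] := HB n.
    apply: (@le_trans _ _ (P (B n))).
      apply: le_measure; rewrite ?inE//; last by move=> w; exact.
      by apply: bigcapT_measurable => k; case: (HB k).
    by apply: le_trans PB _; rewrite lee_fin ltW.
  - by move=> w hw n _; have [_ _] := HB n; exact.
have good_ae : {ae P, forall w, good w}.
  by apply: filterS3 U_ge0 U_increment U_small => w; split.
have null_hits : {ae P, forall w, forall n : nat, ~ hits n.+1%:R^-1 n%:R w}.
  apply/ae_foralln => n; rewrite /almost_everywhere /prop_near1 /nbhs/=.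
  have := hits_null n.+1%:R^-1 n%:R.
  rewrite invr_gt0 ltr0n ler0n => /(_ isT isT).
  by apply: negligibleS => w /= /contrapT.
apply: filterS2 good_ae null_hits => w gw nh t t0 ttau.
apply/eqP => Ut; have [eps eps0 tau_eps] : exists2 e : R, 0 < e & ((t + e)%:E < tau w)%E.
  case: (tau w) ttau => [r| |]// tr; last by exists 1 => //; rewrite ltry.
  exists ((r - t) / 2); first by rewrite divr_gt0// subr_gt0 -lte_fin.
  by move: tr; rewrite !lte_fin; lra.
(* Large enough for both [t <= n] and [2 / (n + 1) <= eps]. *)
pose n := (Num.truncn t + Num.truncn (2 / eps)).+1.
apply: (nh n); split=> //; exists t; split => //.
  apply: ltW; apply: lt_le_trans (truncnS_gt _) _.
  by rewrite ler_nat ltnS leq_addr.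
apply: le_lt_trans tau_eps; rewrite lee_fin lerD2l -ler_pdivlMl// invf_ple ?posrE//; last first.
  by rewrite mulr_gt0 ?invr_gt0.
apply: ltW; rewrite invfM invrK; apply: lt_le_trans (truncnS_gt _) _.
rewrite ler_nat /n mulrC ltnS; apply: leq_trans (leqnSn _).
by rewrite leq_addl.
Qed.

End NeverZero.
End Survival.

(** * Infinite variation of Brownian motion *)

Section Variation.
Context {d : measure_display} {T : measurableType d} {R : realType}.
Variables (P : probability T R) (N : nat) (A : 'M[R]_N) (W : 'I_N -> T -> R -> R).
Hypothesis W_brownian : brownian P A W.
Variable v : 'rV[R]_N.
Hypothesis q_gt0 : 0 < (v *m A *m v^T) 0 0.

Let q := (v *m A *m v^T) 0 0.

Let W_meas i t : 0 <= t -> measurable_fun setT (fun w => W i w t).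
Proof. by case: W_brownian => _ + _ _ _; exact. Qed.

Let inc_meas (s t : R) : 0 <= s -> s <= t -> measurable_fun setT (increment W v s t).
Proof.
move=> s0 st; apply: measurable_sum => i; apply: measurable_funM => //.
by apply: measurable_funB; apply: W_meas => //; exact: le_trans st.
Qed.

(* If [n] increments have absolute values with sum at most [M], at least half of
   them are at most [2 M / n], while each of them is so with probability of order
   [1 / sqrt n] only. *)
Lemma bounded_variation_prob (r1 r2 M : R) n : 0 <= r1 -> r1 < r2 -> 0 < M ->
  let s k := r1 + (r2 - r1) * (k%:R / n.+1%:R) in
  let H := [set w | \sum_(k < n.+1) `|increment W v (s k) (s k.+1) w| <= M] in
  measurable H /\
  (P H <= (8 * M / Num.sqrt ((r2 - r1) * q) / Num.sqrt n.+1%:R)%:E)%E.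
Proof.
move=> r10 r12 M0 s H.
have n0 : 0 < n.+1%:R :> R by rewrite ltr0n.
have r12' : 0 < r2 - r1 by rewrite subr_gt0.
have s_step k : s k.+1 - s k = (r2 - r1) / n.+1%:R.
  by rewrite /s -[k.+1%:R]natr1; field; rewrite gt_eqF.
have s_le k : s k <= s k.+1.
  by rewrite -subr_ge0 s_step divr_ge0// ltW.
have s0 k : 0 <= s k by rewrite addr_ge0// mulr_ge0// ?divr_ge0 ?(ltW r12').
pose f k w := `|increment W v (s k) (s k.+1) w|.
have mf k : measurable_fun setT (f k).
  by apply: measurableT_comp; [exact: normr_measurable|exact: inc_meas].
have mH : measurable H.
  have msum : measurable_fun setT (fun w => \sum_(k < n.+1) f k w).
    by apply: measurable_sum => k; exact: mf.
  have -> : H = (fun w => \sum_(k < n.+1) f k w) @^-1` `]-oo, M].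
    by apply/seteqP; split=> w; rewrite /H /= in_itv/=.
  by rewrite -[_ @^-1` _]setTI; exact: msum.
split => //.
pose a := 2 * M / n.+1%:R; have a0 : 0 < a by rewrite !divr_gt0// mulr_gt0.
pose G k := [set w | f k w <= a].
have mG k : measurable (G k).
  have -> : G k = f k @^-1` `]-oo, a].
    by apply/seteqP; split=> w; rewrite /G /= in_itv/=.
  by rewrite -[_ @^-1` _]setTI; exact: mf.
have PG k : (P (G k) <= (2 * a / Num.sqrt ((r2 - r1) / n.+1%:R * q))%:E)%E.
  have -> : G k = (fun w => increment W v (s k) (s k.+1) w) @^-1` `[- a, a].
    by apply/seteqP; split=> w; rewrite /G /f /= in_itv/= ler_norml.
  case: W_brownian => _ _ _ _ -> //.
  have hq : 0 < (r2 - r1) / n.+1%:R * q by rewrite mulr_gt0// divr_gt0.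
  rewrite s_step centered_normal_pos//.
  by apply: normal_prob_interval_le; [rewrite sqrtr_gt0|exact: ltW].
have ineq w : ((n.+1%:R / 2 : R)%:E * (\1_H w)%:E <= \sum_(k < n.+1) (\1_(G k) w)%:E)%E.
  rewrite -EFinM sumEFin lee_fin.
  have ind0 k : 0 <= \1_(G k) w :> R by rewrite indicE.
  have [Hw|nHw] := pselect (H w); last first.
    by rewrite [\1_H w]indicE memNset// mulr0 sumr_ge0.
  rewrite [\1_H w]indicE mem_set// mulr1.
  (* A Markov-type count: the indicator of [G k] is at least [1 - f k / a], and on [H] these numbers
     add up to at least [n.+1 - M / a], where [a] makes [M / a] half of [n.+1]. *)
  have half : n.+1%:R / 2 <= \sum_(k < n.+1) (1 - f k w / a).
    rewrite sumrB sumr_const card_ord -mulr_suml.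
    have -> : n.+1%:R / 2 = n.+1%:R - M / a.
      by rewrite /a; field; rewrite !gt_eqF.
    by rewrite lerB// ler_wpM2r// invr_ge0 ltW.
  apply: le_trans half _.
    apply: ler_sum => k _; rewrite indicE; case: (boolP (w \in G k)) => [_|].
      by rewrite gerBl; apply: divr_ge0; [exact: normr_ge0|exact: ltW].
    rewrite notin_setE /G /= => /negP; rewrite -ltNge => lt_f.
    by rewrite subr_le0 ler_pdivlMr// mul1r ltW.
have : ((n.+1%:R / 2)%:E * P H <= \sum_(k < n.+1) P (G k))%E.
  have PE B : measurable B -> P B = (\int[P]_w (\1_B w)%:E)%E.
    by move=> mB; rewrite integral_indic// setIT.
  under eq_bigr do rewrite PE//.
  rewrite PE// -ge0_integral_sum//; last first.
    by move=> k; apply/measurable_EFinP; exact: measurable_indic.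
  rewrite -ge0_integralZl//; last first.
    by apply/measurable_EFinP; exact: measurable_indic.
  apply: ge0_le_integral => //.
  - by apply: measurable_funeM; apply/measurable_EFinP; exact: measurable_indic.
  - by apply: emeasurable_sum => k; apply/measurable_EFinP; exact: measurable_indic.
have -> : P H = (fine (P H))%:E by rewrite fineK// fin_num_measure.
move=> PH_le.
have : ((n.+1%:R / 2)%:E * (fine (P H))%:E <=
    \sum_(k < n.+1) (2 * a / Num.sqrt ((r2 - r1) / n.+1%:R * q))%:E)%E.
  by apply: le_trans PH_le _; apply: lee_sum.
rewrite sumEFin sumr_const card_ord -EFinM !lee_fin -[leRHS]mulr_natr.
set x := fine _; pose sn := Num.sqrt (n.+1%:R : R).
have sn0 : 0 < sn by rewrite sqrtr_gt0.
have snE : n.+1%:R = sn ^+ 2 by rewrite sqr_sqrtr// ltW.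
pose sq := Num.sqrt ((r2 - r1) * q).
have sq0 : 0 < sq by rewrite sqrtr_gt0 mulr_gt0.
have -> : Num.sqrt ((r2 - r1) / n.+1%:R * q) = sq / sn.
  rewrite mulrAC sqrtrM ?mulr_ge0 ?(ltW r12') ?(ltW q_gt0)//.
  by rewrite sqrtrV// ltW.
rewrite -/sn -/sq /a mulrC -ler_pdivlMr ?divr_gt0// => /le_trans; apply.
rewrite snE le_eqVlt; apply/orP; left; apply/eqP; field.
by rewrite !gt_eqF.
Qed.

(** The exceptional event must not depend on [a], [b] or [V]. Telescoping bounds all variation sums
    by one number [V r2 - V r1], so countably many rational intervals and integer bounds suffice. *)
Lemma infinite_variation : {ae P, forall w, forall a b : R, 0 <= a -> a < b ->
  forall V : R -> R, ~ forall s t, a <= s -> s <= t -> t <= b ->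
      `|increment W v s t w| <= V t - V s}.
Proof.
pose s (r1 r2 : R) n k := r1 + (r2 - r1) * (k%:R / n.+1%:R).
pose H r1 r2 M n := [set w |
  \sum_(k < n.+1) `|increment W v (s r1 r2 n k) (s r1 r2 n k.+1) w| <= M].
have null r1 r2 M : 0 <= r1 -> r1 < r2 -> 0 < M -> P.-negligible (\bigcap_n H r1 r2 M n).
  move=> r10 r12 M0; exists (\bigcap_n H r1 r2 M n); split => //.
    apply: bigcapT_measurable => n.
    exact: (bounded_variation_prob n r10 r12 M0).1.
  pose c := 8 * M / Num.sqrt ((r2 - r1) * q).
  have c0 : 0 < c by rewrite !mulr_gt0// invr_gt0 sqrtr_gt0 mulr_gt0// subr_gt0.
  apply/eqP; rewrite -measure_le0; apply/lee_addgt0Pr => e e0; rewrite add0e.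
  pose n := Num.truncn ((c / e) ^+ 2).
  have [mH PH] := bounded_variation_prob n r10 r12 M0.
  apply: (@le_trans _ _ (P (H r1 r2 M n))).
    apply: le_measure; rewrite ?inE//; last by move=> w; exact.
    by apply: bigcapT_measurable => k; exact: (bounded_variation_prob k r10 r12 M0).1.
  apply: le_trans PH _; rewrite lee_fin -/c.
  have sn0 : 0 < Num.sqrt (n.+1%:R : R) by rewrite sqrtr_gt0 ltr0n.
  rewrite ler_pdivrMr// mulrC -ler_pdivrMr//.
  have ce0 : 0 <= c / e by rewrite divr_ge0// ltW.
  have -> : c / e = Num.sqrt ((c / e) ^+ 2) by rewrite sqrtr_sqr ger0_norm.
  by rewrite ler_wsqrtr// ltW// truncnS_gt.
have null' : {ae P, forall w, forall n k m : nat,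
    ~ (\bigcap_l H (k%:R / n.+1%:R) (k.+1%:R / n.+1%:R) m.+1%:R l) w}.
  apply/ae_foralln => n; apply/ae_foralln => k; apply/ae_foralln => m.
  rewrite /almost_everywhere /prop_near1 /nbhs/=.
  have := @null (k%:R / n.+1%:R) (k.+1%:R / n.+1%:R) m.+1%:R.
  rewrite divr_ge0// ltr_pM2r ?invr_gt0 ?ltr0n// ltr_nat ltnSn => /(_ isT isT isT).
  by apply: negligibleS => w /= /contrapT.
apply: filterS null' => w Hw a b a0 ab V VP.
(* The mesh [1 / (n + 1)] is below half of [b - a], so the grid interval starting at the first grid
   point after [a] fits in [[a, b]]. *)
pose n := Num.truncn (2 / (b - a)); pose k := (Num.truncn (a * n.+1%:R)).+1.
have ba0 : 0 < b - a by rewrite subr_gt0.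
have n0 : 0 < n.+1%:R :> R by rewrite ltr0n.
have n_lt : n.+1%:R^-1 < (b - a) / 2.
  rewrite invf_plt ?posrE ?divr_gt0// invfM invrK mulrC.
  exact: truncnS_gt.
set z := n.+1%:R^-1 in n_lt.
pose r1 := k%:R / n.+1%:R : R; pose r2 := k.+1%:R / n.+1%:R : R.
have r2E : r2 = r1 + z by rewrite /r2 -natr1 mulrDl mul1r.
have z0 : 0 < z by rewrite invr_gt0.
have ar1 : a <= r1 by rewrite ler_pdivlMr// ltW// truncnS_gt.
have r1_le : r1 <= a + z.
  rewrite ler_pdivrMr// mulrDl mulVf ?gt_eqF// /k -[leLHS]natr1 lerD2r.
  by rewrite truncn_le mulr_ge0// ltW.
have r2b : r2 <= b by rewrite r2E; lra.
pose m := Num.truncn (V r2 - V r1).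
apply: (Hw n k m) => l _ /=; rewrite -/r1 -/r2.
apply: (@le_trans _ _ (\sum_(k < l.+1) (V (s r1 r2 l k.+1) - V (s r1 r2 l k)))).
  have l0 : 0 < l.+1%:R :> R by rewrite ltr0n.
  apply: ler_sum => i _; apply: VP; rewrite /s.
  - apply: le_trans ar1 _; rewrite lerDl mulr_ge0// ?divr_ge0//.
    by rewrite r2E; lra.
  - rewrite lerD2l ler_wpM2l//; first by rewrite r2E; lra.
    by rewrite ler_wpM2r ?invr_ge0 ?(ltW l0)// ler_nat.
  - apply: le_trans r2b; rewrite -lerBrDl -[leRHS]mulr1 ler_wpM2l//.
      by rewrite r2E; lra.
    by rewrite ler_pdivrMr// mul1r ler_nat ltn_ord.
rewrite -(big_mkord xpredT (fun i => V (s r1 r2 l i.+1) - V (s r1 r2 l i))).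
rewrite telescope_sumr// {1}/s divff ?mulr1; last by rewrite pnatr_eq0.
rewrite /s mul0r mulr0 addr0 [r1 + _]addrC subrK.
by rewrite ltW// truncnS_gt.
Qed.

End Variation.

(** * Subcriticality of the active nodes *)

Lemma ae_forall_countable d (T : measurableType d) (R : realType)
    (mu : {measure set T -> \bar R}) (I : countType) (Pr : I -> T -> Prop) :
  (forall i, {ae mu, forall w, Pr i w}) -> {ae mu, forall w, forall i, Pr i w}.
Proof.
move=> aePr; pose Pn n w := if unpickle n is Some i then Pr i w else True.
have : {ae mu, forall w, forall n, Pn n w}.
  apply/ae_foralln => n; rewrite /Pn; case: unpickle => [i|]; first exact: aePr.
  exact: aeW.
by apply: filterS => w Pw i; have := Pw (pickle i); rewrite /Pn pickleK.
Qed.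

Lemma filtered_cvg_sum (R : realType) (X : Type) (F : set_system X) (I : Type)
    (r : seq I) (f : I -> X -> R) (l : I -> R) : Filter F ->
  (forall i, f i x @[x --> F] --> l i) ->
  \sum_(i <- r) f i x @[x --> F] --> \sum_(i <- r) l i.
Proof.
move=> FF fl; elim: r => [|i r IH].
  under eq_fun do rewrite big_nil.
  by rewrite big_nil; exact: cvg_cst.
under eq_fun do rewrite big_cons.
by rewrite big_cons; exact: cvgD.
Qed.

Section Paths.
Variables (R : realType) (N : nat) (Q : 'M[R]_N) (xi : 'I_N -> R) (W L : 'I_N -> R -> R).

Definition reflected_path i (t : R) :=
  xi i + W i t - \sum_j Q i j * L j t + L i t.

Lemma reflected_path_continuous (D : set R) i :
  (forall i, {within D, continuous (W i)}) -> (forall i, {within D, continuous (L i)}) ->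
  {within D, continuous (reflected_path i)}.
Proof.
move=> Wc Lc; apply/subspace_continuousP => t Dt.
have Wt j : W j @ within D (nbhs t) --> W j t by move: (Wc j) => /subspace_continuousP; apply.
have Lt j : L j @ within D (nbhs t) --> L j t by move: (Lc j) => /subspace_continuousP; apply.
apply: cvgD => //; apply: cvgB; first by apply: cvgD => //; exact: cvg_cst.
by apply: filtered_cvg_sum => j; apply: cvgM => //; exact: cvg_cst.
Qed.

(* For a left subsolution [v] the terms in [L] contribute
   [- \sum_j ((v Q) j - v j) (L j t - L j s) <= 0]. *)
Lemma weighted_reflected_path_increment (v : 'I_N -> R) (s t : R) :
  (forall j, v j <= \sum_i v i * Q i j) -> (forall j, L j s <= L j t) ->
  \sum_i v i * reflected_path i t - \sum_i v i * reflected_path i s <=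
  \sum_i v i * (W i t - W i s).
Proof.
move=> v_le L_le; rewrite -subr_ge0.
have -> : \sum_i v i * (W i t - W i s) -
    (\sum_i v i * reflected_path i t - \sum_i v i * reflected_path i s) =
    \sum_j (\sum_i v i * Q i j - v j) * (L j t - L j s).
  under [RHS]eq_bigr do rewrite mulrBl mulr_suml.
  rewrite [RHS]sumrB exchange_big/= -!sumrB; apply: eq_bigr => i _.
  rewrite /reflected_path.
  have -> : \sum_j v i * Q i j * (L j t - L j s) =
      v i * (\sum_j Q i j * L j t - \sum_j Q i j * L j s).
    by rewrite -sumrB mulr_sumr; apply: eq_bigr => j _; ring.
  by ring.
by apply: sumr_ge0 => j _; rewrite mulr_ge0// subr_ge0.
Qed.

End Paths.

(** * Positivity of weighted sums of the coordinates *)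

Section Degenerate.
Context {d : measure_display} {T : measurableType d} {R : realType}.
Variables (P : probability T R) (N : nat) (A Q : 'M[R]_N) (W : 'I_N -> T -> R -> R).
Variable xi : 'I_N -> T -> R.
Hypothesis W_brownian : brownian P A W.
Hypothesis xi_meas : forall i, measurable_fun setT (xi i).
Hypothesis xi_W_indep : independent P <<s events [set: 'I_N] xi >>
    <<s events [set it : 'I_N * R | 0 <= it.2] (fun it w => W it.1 w it.2) >>.

Let W_cont : {ae P, forall w, forall i, {within [set t | 0 <= t], continuous (W i w)}}.
Proof.
by case: W_brownian => _ _ + _ _; apply: filterS => w Hw i; case: (Hw i).
Qed.

Section Weights.
Variable v : 'I_N -> R.
Let vr : 'rV[R]_N := \row_j v j.

Lemma incrementE s t w : increment W vr s t w = \sum_i v i * (W i w t - W i w s).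
Proof. by apply: eq_bigr => i _; rewrite mxE. Qed.

(* A linear combination of variance zero vanishes almost surely at the points
   [k / (n + 1)], hence everywhere by continuity. *)
Lemma increment_degenerate : (vr *m A *m vr^T) 0 0 = 0 ->
  {ae P, forall w, forall s t : R, 0 <= s -> s <= t -> increment W vr s t w = 0}.
Proof.
move=> q0.
have grid : {ae P, forall w, forall n k : nat, increment W vr 0 (k%:R / n.+1%:R) w = 0}.
  apply/ae_foralln => n; apply/ae_foralln => k.
  have t0 : 0 <= k%:R / n.+1%:R :> R by rewrite divr_ge0.
  exists (increment W vr 0 (k%:R / n.+1%:R) @^-1` (~` [set 0])); split.
  - rewrite -[_ @^-1` _]setTI.
    suff : measurable_fun setT (increment W vr 0 (k%:R / n.+1%:R)).
      by apply => //; apply: measurableC; exact: measurable_set1.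
    case: W_brownian => _ mW _ _ _; apply: measurable_sum => i.
    by apply: measurable_funM => //; apply: measurable_funB; exact: mW.
  - have mC0 : measurable (~` [set (0 : R)]).
      by apply: measurableC; exact: measurable_set1.
    case: W_brownian => _ _ _ _ /(_ _ _ vr _ (lexx 0) t0 mC0) W_law.
    apply: etrans W_law _; rewrite q0 mulr0 /centered_normal eqxx diracE memNset//=.
  - by move=> w.
apply: filterS2 grid W_cont => w w_grid Wc.
have zero t : 0 <= t -> increment W vr 0 t w = 0.
  move=> t0; apply: contrapT => /eqP inc_neq0.
  have inc_c : {within [set t : R | 0 <= t], continuous (fun t => increment W vr 0 t w)}.
    apply/subspace_continuousP => r r0; apply: filtered_cvg_sum => i.
    apply: cvgM; first exact: cvg_cst.
    apply: cvgB; last exact: cvg_cst.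
    by move: (Wc i) => /subspace_continuousP; apply.
  have inc_gt0 : 0 < `|increment W vr 0 t w| by rewrite normr_gt0.
  have [e e0 He] := within_continuous_dist inc_c t0 inc_gt0.
  pose n := Num.truncn e^-1; have n0 : 0 < n.+1%:R :> R by rewrite ltr0n.
  have n_e : n.+1%:R^-1 < e by rewrite invf_plt ?posrE// truncnS_gt.
  pose k := (Num.truncn (t * n.+1%:R)).+1; pose r : R := k%:R / n.+1%:R.
  have tr : t < r by rewrite /r ltr_pdivlMr// truncnS_gt.
  have r_le : r <= t + n.+1%:R^-1.
    rewrite /r ler_pdivrMr// mulrDl mulVf ?gt_eqF// /k -[leLHS]natr1 lerD2r.
    by rewrite truncn_le mulr_ge0// ltW.
  have r0 : 0 <= r by rewrite divr_ge0.
  have := He r r0; rewrite gtr0_norm ?subr_gt0// w_grid sub0r normrN ltxx.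
  have r_lt : r - t < e by rewrite ltrBlDl; apply: le_lt_trans r_le _; rewrite ltrD2l.
  by move=> /(_ r_lt).
move=> s t s0 st; have := increment_split W vr 0 s t w.
by rewrite !zero ?add0r//; exact: le_trans st.
Qed.

End Weights.

Lemma single_weight (j : 'I_N) : let e := delta_mx 0 j : 'rV[R]_N in
  (e *m A *m e^T) 0 0 = A j j /\
  forall s t w, increment W e s t w = W j w t - W j w s.
Proof.
split=> [|s t w]; first by rewrite -rowE trmx_delta -colE !mxE.
rewrite /increment (bigD1 j)//= big1 ?addr0 => [|i /negPf ij].
  by rewrite mxE !eqxx mul1r.
by rewrite mxE ij andbF mul0r.
Qed.

Variables (L : 'I_N -> T -> R -> R) (tau : T -> \bar R) (X : 'I_N -> T -> R -> R).
Hypothesis tau_stopping : stopping_time (filtration xi W) tau.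
Hypothesis L_adapted : adapted (filtration xi W) tau L.
Hypothesis L_cont : {ae P, forall w, forall i,
  {within [set t | 0 <= t /\ (t%:E < tau w)%E], continuous (L i w)}}.
Hypothesis X_assoc : associated P Q xi W L tau X.
Hypothesis Q_ge0 : forall i j, 0 <= Q i j.

(** [X] equals this path only almost surely and before [tau]; the explicit formula in [W] and [L] is
    what makes the weighted sum [U] adapted. *)
Let Y w i t := reflected_path Q (fun i => xi i w) (fun i => W i w) (fun i => L i w) i t.

Variable v : 'I_N -> R.
Hypothesis v_ge0 : forall i, 0 <= v i.
Hypothesis v_le : forall j, v j <= \sum_i v i * Q i j.
Let vr : 'rV[R]_N := \row_j v j.

Let U t w := \sum_i v i * Y w i t.

Let U_adapted (delta t : R) : 0 <= t ->
  filtration xi W t ([set w | (t%:E < tau w)%E] `&` [set w | U t w <= delta]).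
Proof.
move=> t0; set D := [set w | _].
have -> : [set w | U t w <= delta] = U t @^-1` `]-oo, delta].
  by apply/seteqP; split=> w /=; rewrite in_itv.
pose G := g_sigma_algebraType (events [set: 'I_N] xi `|` past W t).
suff : @measurable_fun _ _ G R D (U t).
  have FD : filtration xi W t D.
    have -> : D = ~` [set w | (tau w <= t%:E)%E].
      by apply/seteqP; split=> w /=; rewrite /D/= ltNge => /negP.
    by apply: g_sigma_setC; case: tau_stopping => _; exact.
  by move=> /(_ FD _ (measurable_itv `]-oo, delta])).
have mL j : @measurable_fun _ _ G R D (fun w => L j w t).
  by move=> _ B mB; exact: L_adapted.
apply: measurable_sum => i; apply: measurable_funM => //.
apply: measurable_funD => //; apply: measurable_funB.
  apply: measurable_funD; apply: measurable_funTS; first exact: filtration_xi.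
  exact: filtration_W.
by apply: measurable_sum => j; apply: measurable_funM.
Qed.

Let regular w := [/\ forall i, {within [set t | 0 <= t], continuous (W i w)},
  forall i, {within [set t | 0 <= t /\ (t%:E < tau w)%E], continuous (L i w)},
  forall i (s t : R), 0 <= s -> s <= t -> (t%:E < tau w)%E -> L i w s <= L i w t,
  forall i (t : R), 0 <= t -> (t%:E < tau w)%E -> X i w t = Y w i t &
  forall i (t : R), 0 <= t -> (t%:E < tau w)%E -> 0 <= Y w i t].

Let regular_ae : {ae P, forall w, regular w}.
Proof.
apply: filterS3 W_cont L_cont X_assoc => w Wc Lc sk.
have XE i (t : R) : 0 <= t -> (t%:E < tau w)%E -> X i w t = Y w i t /\ 0 <= X i w t.
  by move=> t0 ttau; case: (sk i) => _ _ _ /(_ t t0 ttau) [-> ?] _.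
split => //.
- by move=> i; case: (sk i).
- by move=> i t t0 ttau; case: (XE i t t0 ttau).
- by move=> i t t0 ttau; case: (XE i t t0 ttau) => <-.
Qed.

Let U_increment w : regular w -> forall s t : R, 0 <= s -> s <= t ->
  (t%:E < tau w)%E -> U t w - U s w <= increment W vr s t w.
Proof.
move=> [_ _ L_nd _ _] s t s0 st ttau; rewrite incrementE.
by apply: weighted_reflected_path_increment => // j; exact: L_nd.
Qed.

Let U_ge0 w : regular w -> forall t : R, 0 <= t -> (t%:E < tau w)%E -> 0 <= U t w.
Proof.
by move=> [_ _ _ _ Y0] t t0 ttau; apply: sumr_ge0 => i _; rewrite mulr_ge0// Y0.
Qed.

Let U_small w : regular w -> forall t : R, 0 <= t -> (t%:E < tau w)%E ->
  U t w = 0 -> forall delta : R, 0 < delta -> exists2 e : R, 0 < e &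
  forall s : R, t <= s -> s < t + e -> (s%:E < tau w)%E -> U s w <= delta.
Proof.
move=> [Wc Lc _ _ _] t t0 ttau Ut delta delta0.
pose D := [set t : R | 0 <= t /\ (t%:E < tau w)%E].
have Uc : {within D, continuous (U ^~ w)}.
  apply/subspace_continuousP => r Dr; apply: filtered_cvg_sum => i.
  apply: cvgM; first exact: cvg_cst.
  suff /subspace_continuousP : {within D, continuous (Y w i)} by apply.
  apply: reflected_path_continuous => // j.
  by apply: continuous_subspaceW (Wc j) => x [].
have [e e0 He] := within_continuous_dist Uc (conj t0 ttau) delta0.
exists e => // s ts ste stau; have Ds : D s by split => //; exact: le_trans ts.
have := He s Ds; rewrite Ut subr0 ger0_norm ?subr_ge0// ltrBlDl => /(_ ste).
by move=> /ltW; apply: le_trans; exact: ler_norm.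
Qed.

(* [never_zero] applies if [v] has positive variance.  If it has variance zero, [U] is
   nonincreasing and stays at zero once it vanishes; then [X j0] vanishes on an
   interval, where [W j0] is the difference of two nondecreasing functions. *)
Lemma weighted_sum_gt0 j0 : 0 < v j0 -> 0 < A j0 j0 ->
  {ae P, forall w, forall t : R, 0 <= t -> (t%:E < tau w)%E ->
    0 < \sum_i v i * X i w t}.
Proof.
move=> vj0 Aj0.
suff U_neq0 : {ae P, forall w, forall t : R, 0 <= t -> (t%:E < tau w)%E -> U t w != 0}.
  apply: filterS2 regular_ae U_neq0 => w reg_w Uw t t0 ttau.
  have -> : \sum_i v i * X i w t = U t w.
    by case: reg_w => _ _ _ XE _; apply: eq_bigr => i _; rewrite XE.
  by rewrite lt_neqAle eq_sym Uw// U_ge0.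
have q_ge0 : 0 <= (vr *m A *m vr^T) 0 0 by case: W_brownian => -[_ +] _ _ _ _; exact.
move: q_ge0; rewrite le_eqVlt => /predU1P[q0|q_gt0]; last first.
  apply: (never_zero W_brownian xi_meas xi_W_indep q_gt0) => //.
  - by apply: filterS regular_ae => w; exact: U_ge0.
  - by apply: filterS regular_ae => w; exact: U_increment.
  - by apply: filterS regular_ae => w; exact: U_small.
have [e_var e_inc] := single_weight j0.
have variation : {ae P, forall w, forall a b : R, 0 <= a -> a < b ->
  forall V : R -> R, ~ forall s t, a <= s -> s <= t -> t <= b ->
      `|W j0 w t - W j0 w s| <= V t - V s}.
  have := @infinite_variation _ _ _ _ _ _ _ W_brownian (delta_mx 0 j0).
  rewrite e_var => /(_ Aj0); apply: filterS => w Hw a b a0 ab V VP.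
  by apply: (Hw a b a0 ab V) => s t a_s st tb; rewrite e_inc; exact: VP.
apply: filterS3 regular_ae (increment_degenerate (esym q0)) variation.
move=> w reg_w inc0 not_bv t t0 ttau; apply/eqP => Ut0.
have [b tb btau] : exists2 b : R, t < b & (b%:E < tau w)%E.
  case: (tau w) ttau => [r| |]// tr; last by exists (t + 1); rewrite ?ltrDl// ltry.
  by move: tr; rewrite lte_fin => tr; exists ((t + r) / 2); rewrite ?lte_fin; lra.
have Yj0 s : t <= s -> s <= b -> Y w j0 s = 0.
  move=> ts sb; have s0 := le_trans t0 ts.
  have stau : (s%:E < tau w)%E by apply: le_lt_trans btau; rewrite lee_fin.
  have Us : U s w <= 0.
    by have := U_increment reg_w t0 ts stau; rewrite inc0// Ut0 subr0.
  case: (reg_w) => _ _ _ _ Y0.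
  have : v j0 * Y w j0 s <= 0.
    apply: le_trans Us; rewrite /U (bigD1 j0)//= lerDl.
    by apply: sumr_ge0 => i _; rewrite mulr_ge0// Y0.
  rewrite pmulr_rle0// => Ys; apply/eqP; rewrite eq_le Ys Y0//.
(* Since [Y w j0] and [xi] contribute nothing to increments on [[t, b]], those of [W j0] are
   differences of increments of the two nondecreasing terms; their sum serves as [V]. *)
apply: (not_bv t b t0 tb (fun s => \sum_j Q j0 j * L j w s + L j0 w s)).
move=> s r ts sr rb; case: (reg_w) => _ _ L_nd _ _.
have s0 := le_trans t0 ts.
have rtau : (r%:E < tau w)%E by apply: le_lt_trans btau; rewrite lee_fin.
have := Yj0 s ts (le_trans sr rb); have := Yj0 r (le_trans ts sr) rb.
rewrite /Y /reflected_path => Yr Ys.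
have L_le j := L_nd j s r s0 sr rtau.
have QL_le : \sum_j Q j0 j * L j w s <= \sum_j Q j0 j * L j w r.
  by apply: ler_sum => j _; rewrite ler_wpM2l.
have := L_le j0; rewrite ler_norml => Lj0.
by apply/andP; split; lra.
Qed.

End Degenerate.

Section Subcritical.
Context {d : measure_display} {T : measurableType d} {R : realType}.
Variables (P : probability T R) (N : nat) (A Q : 'M[R]_N) (W : 'I_N -> T -> R -> R).
Variable xi : 'I_N -> T -> R.
Hypothesis W_brownian : brownian P A W.
Hypothesis xi_meas : forall i, measurable_fun setT (xi i).
Hypothesis xi_W_indep : independent P <<s events [set: 'I_N] xi >>
    <<s events [set it : 'I_N * R | 0 <= it.2] (fun it w => W it.1 w it.2) >>.
Variables (L : 'I_N -> T -> R -> R) (tau : T -> \bar R) (X : 'I_N -> T -> R -> R).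
Hypothesis tau_stopping : stopping_time (filtration xi W) tau.
Hypothesis L_adapted : adapted (filtration xi W) tau L.
Hypothesis L_cont : {ae P, forall w, forall i,
  {within [set t | 0 <= t /\ (t%:E < tau w)%E], continuous (L i w)}}.
Hypothesis X_assoc : associated P Q xi W L tau X.
Hypothesis Q_ge0 : forall i j, 0 <= Q i j.

(** For a fixed set [I] of zeros the alternative is deterministic. If it yields [v], carried by [I],
    then [v X = 0] whenever the zero set is [I], which almost surely never happens before [tau]. *)
Lemma active_subcritical : {ae P, forall w, forall t : R, 0 <= t -> (t%:E < tau w)%E ->
  exists u, strict_supersolution Q (active A Q (zero_set X w t)) u}.
Proof.
suff ae_I : {ae P, forall w, forall I : {set 'I_N}, forall t : R, 0 <= t ->
    (t%:E < tau w)%E -> zero_set X w t = I ->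
    exists u, strict_supersolution Q (active A Q I) u}.
  by apply: filterS ae_I => w Hw t t0 ttau; exact: (Hw _ t t0 ttau erefl).
apply: ae_forall_countable => I.
have [[u Hu]|[v [v_ge0 v_out v_le] [j vj Aj]]] := active_alternative A I Q_ge0.
  by apply: aeW => w t _ _ _; exists u.
have := weighted_sum_gt0 W_brownian xi_meas xi_W_indep tau_stopping L_adapted
  L_cont X_assoc Q_ge0 v_ge0 v_le vj Aj.
apply: filterS => w Hw t t0 ttau zero_I.
have := Hw t t0 ttau; rewrite big1 ?ltxx// => i _.
have [iI|iI] := boolP (i \in I); last by rewrite v_out// mul0r.
by move: iI; rewrite -zero_I inE => /eqP->; rewrite mulr0.
Qed.

End Subcritical.

(** * From the Skorokhod problem to the pathwise comparison *)

Lemma skorokhod_flat (R : realType) (tau : \bar R) (Z X L : R -> R) (a b : R) :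
  skorokhod tau Z X L -> 0 <= a -> a <= b -> (b%:E < tau)%E ->
  (forall s, a < s -> s <= b -> 0 < X s) -> L b = L a.
Proof.
case=> [[_ [L_rc _]] _ L_nd _ L_int] a0 ab btau X_gt0.
have b0 := le_trans a0 ab.
apply: (stieltjes_integral0_constant a0 ab _ _ (L_int b b0 btau)).
- by move=> r s r0 rs sb; apply: L_nd => //; apply: le_lt_trans btau; rewrite lee_fin.
- by move=> s s0 sb; apply: L_rc => //; apply: lt_trans btau; rewrite lte_fin.
- by move=> s /=; rewrite in_itv/= => /andP[a_s sb]; exact: X_gt0.
Qed.

Lemma skorokhod_flat_off (R : realType) (tau : \bar R) (Z X L : R -> R) (a b : R)
    (S : set R) :
  skorokhod tau Z X L -> 0 <= a -> a <= b -> (b%:E < tau)%E ->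
  (L b)%:E = stieltjes_integral L b (\1_S) ->
  (forall s, a < s -> s <= b -> ~ S s) -> L b = L a.
Proof.
case=> [[_ [L_rc _]] L0 L_nd _ _] a0 ab btau L_int nS.
have b0 := le_trans a0 ab.
have tau0 : (0 < tau)%E by apply: le_lt_trans btau; rewrite lee_fin.
apply: (stieltjes_integral_full_constant a0 ab _ _ (L0 tau0) L_int).
- by move=> r s r0 rs sb; apply: L_nd => //; apply: le_lt_trans btau; rewrite lee_fin.
- by move=> s s0 sb; apply: L_rc => //; apply: lt_trans btau; rewrite lte_fin.
- rewrite -subset0 => s [] /=; rewrite in_itv/= => /andP[a_s sb].
  exact: nS.
Qed.

Theorem proposition2p5 (R : realType) (d : measure_display)
  (T : measurableType d) (P : probability T R)
  (N : nat) (N_ge1 : (1 <= N)%N)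
  (xi1 xi2 : 'I_N -> {RV P >-> R})
  (xi_ge0 : {ae P, forall w, forall i, 0 <= xi1 i w /\ 0 <= xi2 i w})
  (xi_le : {ae P, forall w, forall i, xi1 i w <= xi2 i w})
  (Q1 Q2 : 'M[R]_N)
  (Q_le : forall i j, 0 <= Q2 i j <= Q1 i j)
  (A : 'M[R]_N) (W : 'I_N -> T -> R -> R)
  (W_brownian : brownian P A W)
  (W_indep : independent P
    <<s events [set: 'I_N] xi1 `|` events [set: 'I_N] xi2 >>
    <<s events [set it : 'I_N * R | 0 <= it.2] (fun it w => W it.1 w it.2) >>)
  (L1 L2 : 'I_N -> T -> R -> R) (tau1 tau2 : T -> \bar R)
  (L1_max : maximal_solution P A Q1 xi1 W L1 tau1)
  (L2_max : maximal_solution P A Q2 xi2 W L2 tau2)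
  (X1 X2 : 'I_N -> T -> R -> R)
  (X1_assoc : associated P Q1 xi1 W L1 tau1 X1)
  (X2_assoc : associated P Q2 xi2 W L2 tau2 X2) :
  {ae P, forall w, forall (s t : R) (i : 'I_N),
    0 <= s -> s <= t -> (t%:E < Order.min (tau1 w) (tau2 w))%E ->
    X1 i w t <= X2 i w t /\
    L2 i w t - L2 i w s <= L1 i w t - L1 i w s}.
Proof.
have Q2_ge0 i j : 0 <= Q2 i j by case/andP: (Q_le i j).
have xi2_meas i : measurable_fun setT (xi2 i) by [].
have xi2_W_indep : independent P <<s events [set: 'I_N] xi2 >>
    <<s events [set it : 'I_N * R | 0 <= it.2] (fun it w => W it.1 w it.2) >>.
  move=> B C sB sC; apply: W_indep => //; move: B sB; apply: g_sigma_sub => B xiB.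
  by apply: sub_sigma_algebra; right.
case: L1_max => -[_ _ L1_cont _] _.
(* The activity condition comes with its own process [Y]. Almost surely [Y] and [X2] both coincide
   with the reflected path [x2] before [tau2], so their zero sets agree there. *)
case: L2_max => -[tau2_stop L2_adapted L2_cont [Y Y_assoc Y_active]] _.
have sub2 := active_subcritical W_brownian xi2_meas xi2_W_indep tau2_stop L2_adapted
  L2_cont Y_assoc Q2_ge0.
have W_path : {ae P, forall w, forall i, W i w 0 = 0 /\
    {within [set t | 0 <= t], continuous (W i w)}} by case: W_brownian.
apply: filterS3 (filterI xi_le W_path) (filterI (filterI L1_cont L2_cont)
  (filterI X1_assoc X2_assoc)) (filterI sub2 (filterI Y_assoc Y_active)).
move=> w [xi_le_w W_w] [[L1c L2c] [sk1 sk2]] [sub_w [skY actY]] s t i s0 st.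
rewrite lt_min => /andP[ttau1 ttau2]; have t0 := le_trans s0 st.
have lt1 r : r <= t -> (r%:E < tau1 w)%E.
  by move=> rt; apply: le_lt_trans ttau1; rewrite lee_fin.
have lt2 r : r <= t -> (r%:E < tau2 w)%E.
  by move=> rt; apply: le_lt_trans ttau2; rewrite lee_fin.
pose x1 := reflected_path Q1 (fun i => xi1 i w) (fun i => W i w) (fun i => L1 i w).
pose x2 := reflected_path Q2 (fun i => xi2 i w) (fun i => W i w) (fun i => L2 i w).
have X1E j r : 0 <= r -> r <= t -> X1 j w r = x1 j r /\ 0 <= X1 j w r.
  by move=> r0 rt; case: (sk1 j) => _ _ _ /(_ r r0 (lt1 r rt))[-> ?] _.
have X2E j r : 0 <= r -> r <= t -> X2 j w r = x2 j r /\ 0 <= X2 j w r.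
  by move=> r0 rt; case: (sk2 j) => _ _ _ /(_ r r0 (lt2 r rt))[-> ?] _.
have YE j r : 0 <= r -> r <= t -> Y j w r = x2 j r.
  by move=> r0 rt; case: (skY j) => _ _ _ /(_ r r0 (lt2 r rt))[-> _] _.
have zeroE r : 0 <= r -> r <= t -> zero_set Y w r = [set j | x2 j r == 0]%SET.
  by move=> r0 rt; apply/setP => j; rewrite !inE YE.
have Wc j : {within `[0, t], continuous (W j w)}.
  by apply: continuous_subspaceW (W_w j).2 => r /=; rewrite in_itv/= => /andP[].
have L1c' j : {within `[0, t], continuous (L1 j w)}.
  apply: continuous_subspaceW (L1c j) => r /=; rewrite in_itv/= => /andP[r0 rt].
  by split => //; exact: lt1.
have L2c' j : {within `[0, t], continuous (L2 j w)}.
  apply: continuous_subspaceW (L2c j) => r /=; rewrite in_itv/= => /andP[r0 rt].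
  by split => //; exact: lt2.
have tau1_gt0 : (0 < tau1 w)%E by exact: lt1.
have tau2_gt0 : (0 < tau2 w)%E by exact: lt2.
have [] := @pathwise_comparison R N A Q1 Q2 t (fun i => xi1 i w) (fun i => xi2 i w)
  (fun i => W i w) x1 x2 (fun i => L1 i w) (fun i => L2 i w) t0 Q_le xi_le_w
  _ _ _ _ _ _ _ _ _ _ _ _ _ _ _ _ _ i.
- by move=> j; case: (W_w j).
- by move=> j; case: (sk1 j) => _ /(_ tau1_gt0).
- by move=> j; case: (sk2 j) => _ /(_ tau2_gt0).
- by move=> j; exact: reflected_path_continuous.
- by move=> j; exact: reflected_path_continuous.
- exact: L1c'.
- exact: L2c'.
- by move=> j r r0 rt; case: (X1E j r r0 rt) => <-.
- by move=> j r r0 rt; case: (X2E j r r0 rt) => <-.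
- by move=> j a b a0 ab bt; case: (sk1 j) => _ _ L_nd _ _; apply: L_nd => //; exact: lt1.
- by move=> j a b a0 ab bt; case: (sk2 j) => _ _ L_nd _ _; apply: L_nd => //; exact: lt2.
- by [].
- by [].
- move=> j a b a0 ab bt x1_gt0; apply: (skorokhod_flat (sk1 j)) => //; first exact: lt1.
  move=> r ar rb; have r0 := le_trans a0 (ltW ar).
  by case: (X1E j r r0 (le_trans rb bt)) => -> _; exact: x1_gt0.
- move=> j a b a0 ab bt x2_gt0; apply: (skorokhod_flat (sk2 j)) => //; first exact: lt2.
  move=> r ar rb; have r0 := le_trans a0 (ltW ar).
  by case: (X2E j r r0 (le_trans rb bt)) => -> _; exact: x2_gt0.
- move=> j a b a0 ab bt inactive.
  apply: (skorokhod_flat_off (skY j) a0 ab (lt2 b bt) (actY j b _ (lt2 b bt))).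
    exact: le_trans ab.
  move=> r ar rb /=; have r0 := le_trans a0 (ltW ar).
  by rewrite zeroE ?(le_trans rb)//; apply/negP; exact: inactive.
- by move=> r r0 rt; rewrite -zeroE//; apply: sub_w => //; exact: lt2.
move=> incr le_x; split; last exact: incr.
by have [-> _] := X1E i t t0 (lexx t); have [-> _] := X2E i t t0 (lexx t); exact: le_x.
Qed.
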